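(* Fix integers $c\ge 2$ and $r\ge 3$, let $\bm a\in\{1,\dots,c-1\}^r$ be an admissible $r$-palette, and let $\theta_1,\dots,\theta_{c-1}>0$ be such that $\sum_{b\in S(\bm a)}w_b\theta_b<2$ and $\theta_{\max}<1$. Let $$Z_{r,n}(\bm a)=\frac{X_{r,n}(\bm a)-\mathbb E[X_{r,n}(\bm a)]}{\sqrt{\mathrm{Var}[X_{r,n}(\bm a)]}}.$$ Then $$\mathrm{Wass}\big(Z_{r,n}(\bm a),\mathcal N(0,1)\big)\lesssim_r \max\left\{n^{-1+\frac12\sum_{b\in S(\bm a)}w_b\theta_b},\ n^{-\frac12+\frac12\theta_{\max}}\right\}.$$ In particular, $Z_{r,n}(\bm a)$ converges in distribution to $\mathcal N(0,1)$ as $n\to\infty$.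
   Context: Notation: $[n]=\{1,\dots,n\}$. An $r$-AP in $[n]$ is an ordered tuple $\bm x=(x,x+d,\dots,x+(r-1)d)$ with $d\ge 1$ an integer and all entries in $[n]$. An $r$-palette is an ordered sequence $\bm a=(a_1,\dots,a_r)\in[c]^r$; it is admissible if $\bm a\in[c-1]^r$. Given a coloring $\phi_n:[n]\to[c]$, an $r$-AP is $\bm a$-colorful if $\phi_n(x+(s-1)d)=a_s$ for every $s\in[r]$. Random coloring: with fixed $\theta_1,\dots,\theta_{c-1}>0$ and $n$ large, each element of $[n]$ is independently assigned color $b\in[c]$ with probability $p_b$, where $p_b=n^{-\theta_b}$ for $b\in[c-1]$ and $p_c=1-\sum_{b=1}^{c-1}p_b$. $X_{r,n}(\bm a)$ is the number of $\bm a$-colorful $r$-APs in $[n]$ under this random coloring. $S(\bm a)$ is the set of distinct colors appearing in $\bm a$, $w_b$ is the number of times color $b\in S(\bm a)$ appears in $\bm a$, and $\theta_{\max}=\max_{b\in S(\bm a)}\theta_b$. $\mathrm{Wass}(\cdot,\cdot)$ is the Wasserstein ($L^1$) distance between the laws: $\mathrm{Wass}(X,Y)=\sup\{|\mathbb E h(X)-\mathbb E h(Y)|: h:\mathbb R\to\mathbb R \text{ is } 1\text{-Lipschitz}\}$. The notation $u_n\lesssim_r v_n$ means there is a constant $C>0$ depending only on $r$ with $u_n\le Cv_n$ for all sufficiently large $n$. *)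

(* Defs.v *)
From mathcomp Require Import all_boot all_order all_algebra.
From mathcomp Require Import all_classical all_reals all_analysis.

Set Implicit Arguments.
Unset Strict Implicit.
Unset Printing Implicit Defensive.

Import Order.TTheory GRing.Theory Num.Theory.
Import numFieldNormedType.Exports.

Local Open Scope classical_set_scope.
Local Open Scope ring_scope.

(* The integers 1, ..., n and the colors 1, ..., c are both shifted down by
   one: they are the elements of 'I_n and 'I_c, and the last color is c.-1.
   An admissible r-palette, i.e. one avoiding the last color, is an r-tuple
   over 'I_c.-1, which is embedded in 'I_c by widen_ord. *)

Section Palettes.
Variables (c r : nat).

Definition admissible_palette := r.-tuple 'I_c.-1.

Definition embed_color : 'I_c.-1 -> 'I_c := widen_ord (leq_pred c).

Definition palette_colors (a : admissible_palette) : {set 'I_c.-1} :=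
  [set b | b \in a]%SET.

Definition multiplicity (a : admissible_palette) (b : 'I_c.-1) : nat :=
  count_mem b a.

Definition weighted_exponent (R : realType) (theta : 'I_c.-1 -> R)
    (a : admissible_palette) : R :=
  \sum_(b in palette_colors a) (multiplicity a b)%:R * theta b.

(* The default value 0 is harmless for positive exponents and r > 0. *)
Definition max_exponent (R : realType) (theta : 'I_c.-1 -> R)
    (a : admissible_palette) : R :=
  \big[Num.max/0]_(b in palette_colors a) theta b.

End Palettes.

Section ColorfulProgressions.
Variables (c r n : nat).

Definition is_AP (x : r.-tuple 'I_n) : Prop :=
  exists x0 d : nat, (0 < d)%N /\
    forall s : 'I_r, tnth x s = (x0 + s * d)%N :> nat.

Definition colorful (phi : 'I_n -> 'I_c) (a : admissible_palette c r)
    (x : r.-tuple 'I_n) : bool :=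
  [forall s : 'I_r, phi (tnth x s) == embed_color (tnth a s)].

Definition num_colorful_AP (phi : 'I_n -> 'I_c) (a : admissible_palette c r) :
    nat :=
  #|[set x : r.-tuple 'I_n | `[< is_AP x >] && colorful phi a x]%SET|.

End ColorfulProgressions.

(* n^(- theta_b) for every color b but the last one, which receives the
   remaining mass; that mass is nonnegative only for n large enough. *)
Definition color_prob (R : realType) (c : nat) (theta : 'I_c.-1 -> R) (n : nat)
    (b : 'I_c) : R :=
  if insub (val b) is Some b' then n%:R `^ (- theta b')
  else 1 - \sum_(b' < c.-1) n%:R `^ (- theta b').

(* The elements of 'I_n are colored independently, with marginal law p; the
   set of colors carries the discrete sigma-algebra. *)
Record random_coloring (R : realType) d (T : measurableType d)
    (P : probability T R) (c n : nat) (p : 'I_c -> R)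
    (phi : 'I_n -> T -> 'I_c) : Prop := RandomColoring {
  coloring_measurable : forall i (B : set 'I_c), measurable (phi i @^-1` B);
  coloring_law : forall i b, P (phi i @^-1` [set b]) = (p b)%:E;
  coloring_independent : forall (J : {set 'I_n}) (B : 'I_n -> set 'I_c),
    P (\bigcap_(i in [set` J]) (phi i @^-1` B i)) =
    (\prod_(i in J) P (phi i @^-1` B i))%E
}.

Definition colorful_count (R : realType) (T : Type) (c r n : nat)
    (phi : 'I_n -> T -> 'I_c) (a : admissible_palette c r) : T -> R :=
  fun t => (num_colorful_AP (phi ^~ t) a)%:R.

Definition standardize (R : realType) d (T : measurableType d)
    (P : probability T R) (X : T -> R) : T -> R :=
  fun t => (X t - fine 'E_P[X]%E) / Num.sqrt (fine 'V_P[X]%E).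

(* The random variables are allowed to live on different probability spaces;
   both notions depend only on their laws. *)
Definition wasserstein (R : realType)
    d1 (T1 : measurableType d1) (P : probability T1 R) (X : T1 -> R)
    d2 (T2 : measurableType d2) (Q : probability T2 R) (Y : T2 -> R) : \bar R :=
  ereal_sup [set (`|'E_P[h \o X] - 'E_Q[h \o Y]|)%E |
    h in [set h : R -> R | 1.-lipschitz (h : R^o -> R^o)]].

Definition converges_in_distribution (R : realType)
    (d : nat -> measure_display) (T : forall n, measurableType (d n))
    (P : forall n, probability (T n) R) (X : forall n, T n -> R)
    d' (T' : measurableType d') (Q : probability T' R) (Y : T' -> R) : Prop :=
  forall x : R,
    {for x, continuous (fun y : R => fine (Q [set t | Y t <= y]))} ->
    P n [set t | X n t <= x] @[n --> \oo] --> Q [set t | Y t <= x].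

(* Main.v *)
(* Stein's method with local dependence. For a 1-Lipschitz [h], the bounded
   solution of [f' - x f = h - E h(N)] has a Lipschitz derivative, with a
   universal constant. For a normalized sum [W = sum_x Y_x], comparing [W] with
   the sum over the progressions disjoint from [x], and then from [x] and [y],
   bounds [E (f'(W) - W f(W))] by the sum of [E |Y_x Y_y Y_z|] and
   [E |Y_x Y_y| E |Y_z|] over [x], [y] meeting [x], and [z] meeting [x] or [y].

   Write [q = n^(-W)] for the probability that a given progression is colorful.
   A progression meeting a given bounded set in one point costs at most
   [q n^theta_max], and there are [O(n)] of those; the [O(1)] progressions
   meeting it in two points are bounded trivially. With
   [M = max(1, n q n^theta_max)] the triple sums are [O(n^2 q M^2 / sigma^3)].
   The variance is at least of order [n^2 q M]: the diagonal gives [n^2 q] when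
   [n q] is small, and Cauchy-Schwarz against the number of points of the rarest
   color gives [n^3 q^2 n^theta_max]. The quotient is [sqrt(M / (n^2 q))], which
   is the stated maximum. *)

Require Import Defs.
From mathcomp Require Import all_boot all_order all_algebra.
From mathcomp Require Import all_classical all_reals all_analysis.
From mathcomp Require Import measurable_realfun.
From mathcomp Require Import zify ring lra.

Set Implicit Arguments.
Unset Strict Implicit.
Unset Printing Implicit Defensive.

Import Order.TTheory GRing.Theory Num.Theory.
Import numFieldNormedType.Exports.

Local Open Scope classical_set_scope.
Local Open Scope ring_scope.

(** * Stein's equation for the normal law *)

Section RealCalculus.
Variable R : realType.
Implicit Types (f df g k : R -> R) (a b x : R).

(** The Stein solution is never estimated through its integral formula. A solution of [g' = x g + k]
    with [k] of linear growth is bounded by comparison with an explicit barrier, provided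
    [g * gauss] vanishes at infinity, which excludes multiples of [1 / gauss], the solutions of the
    homogeneous equation. Rough growth bounds thus become uniform ones, and the same comparison
    serves each derivative. It needs a differentiable test function, so a Lipschitz one is first
    averaged over a short interval, whose length does not enter the final bound. On the
    probabilistic side, everything is computed as a finite sum over colorings. Centered indicators
    are dominated by the indicator plus its mean, so that correlated and uncorrelated triple sums
    follow from one estimate for a single neighbor. Progressions enter only through three facts:
    their terms are distinct, two terms at known positions determine the progression, and there are
    at least [n^2 / (4 r^2)] of them once [r <= n]. The smallness of the rarest color's probability,
    at most [1 / (2 r^2)], keeps the negative terms of both variance bounds below half of the main
    term. *)

Lemma is_derive1_continuous f df :
  (forall x, is_derive x 1 f (df x)) -> continuous f.
Proof.
move=> fdf x; apply/differentiable_continuous/derivable1_diffP.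
exact: (@ex_derive _ _ _ _ _ _ _ (fdf x)).
Qed.

Lemma MVT_global f df a b : (forall x, is_derive x 1 f (df x)) -> a < b ->
  exists2 c, a < c < b & f b - f a = df c * (b - a).
Proof.
move=> fdf ab; have [|c] := @MVT _ f df _ _ ab (fun x _ => fdf x).
  by apply: continuous_subspaceT; exact: is_derive1_continuous fdf.
by rewrite in_itv /= => cab ->; exists c.
Qed.

Lemma is_derive1_lipschitz f df K : (forall x, is_derive x 1 f (df x)) ->
  (forall x, `|df x| <= K) -> forall x y, `|f y - f x| <= K * `|y - x|.
Proof.
move=> fdf dfK x y; wlog xy : x y / x < y => [hw|].
  case: (ltgtP x y) => [xy|yx|->]; last by rewrite !subrr normr0 mulr0.
    exact: hw.
  by rewrite distrC (distrC y); exact: hw.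
have [c _ ->] := MVT_global fdf xy.
by rewrite normrM ler_wpM2r.
Qed.

Lemma taylor1_lipschitz f df K : (forall x, is_derive x 1 f (df x)) ->
  (forall x y, `|df y - df x| <= K * `|y - x|) ->
  forall x y, `|f y - f x - (y - x) * df x| <= K * (y - x) ^+ 2.
Proof.
move=> fdf dfK x y.
have K0 : 0 <= K.
  have := dfK 0 1; rewrite subr0 normr1 mulr1; exact: le_trans.
have aux a b z c : a < b -> z = a \/ z = b -> a < c < b ->
    `|df c * (b - a) - (b - a) * df z| <= K * (b - a) ^+ 2.
  move=> ab zab /andP[ac cb].
  rewrite [_ * df z]mulrC -mulrBl normrM (gtr0_norm (_ : 0 < b - a)) ?subr_gt0//.
  rewrite expr2 mulrA ler_wpM2r ?subr_ge0 ?(ltW ab)//.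
  apply: le_trans (dfK _ _) _; rewrite ler_wpM2l//.
  by case: zab => ->; rewrite ler_norml; apply/andP; split; lra.
have [xy|yx|->] := ltgtP x y; last by rewrite !subrr mul0r subr0 normr0 expr0n mulr0.
- have [c cxy ->] := MVT_global fdf xy.
  by apply: aux => //; left.
- have [c cxy fE] := MVT_global fdf yx.
  have -> : f y - f x - (y - x) * df x = - (df c * (x - y) - (x - y) * df x).
    by rewrite -fE; ring.
  by rewrite normrN -(sqrrN (y - x)) opprB; apply: aux => //; right.
Qed.

Definition gauss x := normal_pdf (0 : R) 1 x.

Lemma gaussE x : gauss x = normal_peak 1 * expR (- x ^+ 2 / 2).
Proof.
by rewrite /gauss normal_pdfE ?oner_eq0// /normal_fun subr0 expr1n.
Qed.

Lemma gauss_gt0 x : 0 < gauss x.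
Proof. by rewrite gaussE mulr_gt0 ?expR_gt0// normal_peak_gt0// oner_eq0. Qed.

Lemma gaussN x : gauss (- x) = gauss x.
Proof. by rewrite !gaussE sqrrN. Qed.

Lemma is_derive_gauss x : is_derive x 1 gauss (- x * gauss x).
Proof.
rewrite gaussE.
have -> : gauss = (normal_peak 1 : R) *: (expR \o (fun y => (- 2^-1) *: y ^+ 2)).
  by apply/funext => y; rewrite gaussE /GRing.scale /= mulNr mulNr [_ * y ^+ 2]mulrC.
apply: is_derive_eq.
rewrite /GRing.scale/=.
have -> : - 2^-1 * x ^+ 2 = - x ^+ 2 / 2 by rewrite mulNr mulrC mulNr.
by rewrite mulr1; field.
Qed.

Lemma gauss_le x : x ^+ 2 * gauss x <= 2 * normal_peak 1.
Proof.
have p0 : 0 < normal_peak (1 : R) by rewrite normal_peak_gt0// oner_eq0.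
rewrite gaussE mulrCA [2 * _]mulrC ler_pM2l// mulNr expRN.
rewrite ler_pdivrMr ?expR_gt0//.
have := expR_ge1Dx (x ^+ 2 / 2); have := sqr_ge0 x; lra.
Qed.

(* The function [(a + 2 b / (1 + x)) * gauss x] is a barrier: its derivative
   is at most [- (a x + b) * gauss x] for nonnegative [x]. *)
Lemma barrier_right g k a b : 0 <= a -> 0 <= b ->
  (forall x, is_derive x 1 g (x * g x + k x)) ->
  (forall x, `|k x| <= a * `|x| + b) ->
  (forall e : R, 0 < e -> exists M, forall x, M <= x -> `|g x| * gauss x <= e) ->
  forall x, 0 <= x -> `|g x| <= a + 2 * b.
Proof.
move=> a0 b0 gE kab glim.
pose U (x : R) := (a + 2 * b / (1 + x)) * gauss x.
have main (s : R) : s = 1 \/ s = -1 -> forall x, 0 <= x -> 0 <= U x + s * (g x * gauss x).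
  move=> s1 x x0; rewrite leNgt; apply/negP => phi0.
  pose phi (x : R) := U x + s * (g x * gauss x).
  pose dphi (x : R) : R := (- (2 * b / (1 + x) ^+ 2)) * gauss x
    + (a + 2 * b / (1 + x)) * (- x * gauss x) + s * (k x * gauss x).
  have dphiE (y : R) : 0 <= y -> is_derive y 1 phi (dphi y).
    move=> y0; have y1 : 1 + y != 0 by rewrite gt_eqF// ltr_wpDr.
    have dg := is_derive_gauss y; have dgk := gE y.
    have dV : is_derive y 1 (fun y => (1 + y)^-1) (- (1 + y) ^- 2 *: (0 + 1) : R).
      by apply: (@is_deriveV _ (fun y => 1 + y)) => //.
    have -> : phi = ((cst a + (2 * b) *: (fun y => (1 + y)^-1)) * gauss
                 + s *: (g * gauss)).
      by apply/funext => z.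
    have d1 := is_deriveD (is_derive_cst a y 1) (is_deriveZ (2 * b) dV).
    have d2 := is_deriveD (is_deriveM d1 dg) (is_deriveZ s (is_deriveM dgk dg)).
    apply: (is_derive_eq d2).
    rewrite /GRing.scale /= /dphi.
    rewrite -[(cst a + _) y]/(a + 2 * b * (1 + y)^-1).
    set G := gauss y; set w := (1 + y)^-1; rewrite -[(1 + y) ^- 2]exprVn -/w.
    ring.
  have dphi_le (y : R) : 0 <= y -> dphi y <= 0.
    move=> y0; rewrite /dphi.
    have -> : - (2 * b / (1 + y) ^+ 2) * gauss y
      + (a + 2 * b / (1 + y)) * (- y * gauss y) + s * (k y * gauss y) =
      - gauss y * (2 * b / (1 + y) ^+ 2 + (a + 2 * b / (1 + y)) * y - s * k y) by ring.
    rewrite mulNr oppr_le0 mulr_ge0// ?(ltW (gauss_gt0 _))// subr_ge0.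
    have sk : s * k y <= a * y + b.
      have := kab y; rewrite (ger0_norm y0).
      by case: s1 => ->; rewrite ?mul1r ?mulN1r ler_norml => /andP[]; lra.
    apply: le_trans sk _.
    have y1 : 0 < 1 + y by lra.
    have -> : 2 * b / (1 + y) ^+ 2 + (a + 2 * b / (1 + y)) * y =
       a * y + b * ((2 + 2 * y * (1 + y)) / (1 + y) ^+ 2) by field; rewrite gt_eqF.
    rewrite lerD2l ler_peMr// ler_pdivlMr ?exprn_gt0//.
    have := sqr_ge0 y; rewrite !expr2; lra.
  (* A negative value at [x] would persist to the right because [phi] is nonincreasing, yet far out
     [g * gauss] is at most half of it in size and [U] is nonnegative. *)
  have [M HM] := glim (- phi x / 2) ltac:(rewrite /phi; lra).
  pose y := Num.max M (x + 1).
  have xy : x < y by rewrite lt_max ltrDl ltr01 orbT.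
  have /HM gy : M <= y by rewrite le_max lexx.
  have : phi y <= phi x.
    have dxy (z : R) : z \in `]x, y[ -> is_derive z 1 phi (dphi z).
      by rewrite in_itv/= => /andP[xz _]; apply: dphiE; lra.
    have [|c] := @MVT _ phi dphi _ _ xy dxy.
    - apply: derivable_within_continuous => z; rewrite in_itv/= => /andP[xz _].
      by have [] := dphiE z ltac:(lra).
    - rewrite in_itv/= => /andP[xc _] E.
      rewrite -subr_le0 E; apply: mulr_le0_ge0; first by apply: dphi_le; lra.
      by rewrite subr_ge0 ltW.
  have Uy : 0 <= U y.
    rewrite /U mulr_ge0// ?(ltW (gauss_gt0 _))// addr_ge0// mulr_ge0//.
      by rewrite mulr_ge0.
    by rewrite invr_ge0; lra.
  have : - (`|g y| * gauss y) <= s * (g y * gauss y).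
    rewrite -[gauss y in leLHS](gtr0_norm (gauss_gt0 y)) -normrM.
    by case: s1 => ->; rewrite ?mul1r ?mulN1r ?lerN2 ?lerNnormlW ?ler_norm.
  by rewrite /phi in gy phi0 *; lra.
move=> x x0.
have Ux : U x <= (a + 2 * b) * gauss x.
  rewrite ler_pM2r ?gauss_gt0// lerD2l ler_pdivrMr ?ler_peMr//; last lra.
    by rewrite mulr_ge0.
  lra.
have := main 1 (or_introl erefl) _ x0; have := main (-1) (or_intror erefl) _ x0.
rewrite mulN1r mul1r => h1 h2.
rewrite -(ler_pM2r (gauss_gt0 x)) -[X in `|_| * X](gtr0_norm (gauss_gt0 x)) -normrM.
rewrite ler_norml; lra.
Qed.

(** The reflection [- g (- y)] solves an equation of the same form with source [k (- y)], which
    transfers the bound to the negative half-line. *)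
Lemma barrier g k a b : 0 <= a -> 0 <= b ->
  (forall x, is_derive x 1 g (x * g x + k x)) ->
  (forall x, `|k x| <= a * `|x| + b) ->
  (forall e : R, 0 < e -> exists M, forall x, M <= `|x| -> `|g x| * gauss x <= e) ->
  forall x, `|g x| <= a + 2 * b.
Proof.
move=> a0 b0 gE kab glim x; have [x0|x0] := leP 0 x.
  apply: (barrier_right a0 b0 gE kab) => // e /glim[M HM].
  by exists M => y My; apply: HM; exact: le_trans My (ler_norm _).
pose g' (y : R) := - g (- y).
have -> : `|g x| = `|g' (- x)| by rewrite /g' opprK normrN.
apply: (@barrier_right g' (fun y => k (- y))) => //; last by lra.
- move=> y; have dg := gE (- y).
  have dc : is_derive y 1 (g \o -%R) (- 1 * (- y * g (- y) + k (- y))).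
    by apply: is_derive_eq; rewrite mulrC.
  have -> : g' = - (g \o -%R) by apply/funext.
  by apply: is_derive_eq; rewrite -[(- (g \o -%R)) y]/(- g (- y)); ring.
- by move=> y; rewrite -(normrN y).
- move=> e /glim[M HM]; exists M => y My; rewrite /g' normrN -gaussN.
  by apply: HM; rewrite normrN; exact: le_trans My (ler_norm _).
Qed.

Lemma linear_growth_gauss_lim g (A B : R) : 0 <= A -> 0 <= B ->
  (forall x, 1 <= `|x| -> `|g x| <= A + B * `|x|) ->
  forall e : R, 0 < e -> exists M, forall x, M <= `|x| -> `|g x| * gauss x <= e.
Proof.
move=> A0 B0 gAB e e0.
have p0 : 0 < normal_peak (1 : R) by rewrite normal_peak_gt0// oner_eq0.
exists (Num.max 1 ((A + B) * (2 * normal_peak 1) / e)) => x.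
rewrite ge_max => /andP[x1]; rewrite ler_pdivrMr// => xM.
have x0 : 0 < `|x| by apply: lt_le_trans x1.
rewrite -(ler_pM2l x0); apply: le_trans xM.
apply: (@le_trans _ _ ((A + B) * (`|x| ^+ 2 * gauss x))); last first.
  by rewrite ler_wpM2l ?addr_ge0// real_normK ?num_real// gauss_le.
rewrite [leLHS]mulrA [leRHS]mulrA ler_pM2r ?gauss_gt0//.
rewrite [`|x| ^+ 2]expr2 [(A + B) * _]mulrA [leLHS]mulrC ler_pM2r//.
apply: le_trans (gAB _ x1) _; rewrite mulrDl lerD2r.
by rewrite ler_peMr.
Qed.

End RealCalculus.

(** * Integration against the Gaussian density *)

Section GaussianIntegral.
Variable R : realType.
Implicit Types (h k : R -> R) (a b x : R).
Local Notation mu := (@lebesgue_measure R).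
Local Notation N01 := (normal_prob (0 : R) 1).

Lemma continuous_gauss : continuous (@gauss R).
Proof. by apply: continuous_normal_pdf; rewrite oner_eq0. Qed.

(** The change of variables is phrased with the Radon-Nikodym derivative; it agrees with [gauss]
    almost everywhere because both have the same integral over every measurable set. *)
Lemma ge0_integral_normal_prob (f : R -> \bar R) : (forall x, 0 <= f x)%E ->
  measurable_fun [set: R] f ->
  (\int[N01]_x f x = \int[mu]_x (f x * (gauss x)%:E))%E.
Proof.
move=> f0 mf; have Nmu := normal_prob_dominates (0 : R) 1.
rewrite -(Radon_Nikodym_SigmaFinite.change_of_variables Nmu)//.
have rnI := Radon_Nikodym_SigmaFinite.f_integrable Nmu.
apply: ae_eq_integral => //.
- by apply: emeasurable_funM => //; exact: measurable_int rnI.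
- apply: emeasurable_funM => //; apply/measurable_EFinP.
  exact: measurable_normal_pdf.
- apply: ae_eqe_mul2l; apply: integral_ae_eq => //.
  + by apply/measurable_EFinP; exact: measurable_normal_pdf.
  + by move=> E _ mE; rewrite -Radon_Nikodym_SigmaFinite.f_integral.
Qed.

Lemma integral_normal_prob (f : R -> R) :
  mu.-integrable setT (fun x => (f x * gauss x)%:E) -> measurable_fun [set: R] f ->
  N01.-integrable setT (EFin \o f) /\
  (\int[N01]_x (f x)%:E = \int[mu]_x (f x * gauss x)%:E)%E.
Proof.
move=> fgI mf; have Nmu := normal_prob_dominates (0 : R) 1.
have mEf : measurable_fun setT (EFin \o f) by exact/measurable_EFinP.
have fI : N01.-integrable setT (EFin \o f).
  apply/integrableP; split => //.
  rewrite ge0_integral_normal_prob//; last exact: measurableT_comp.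
  case/integrableP : fgI => _; apply: le_lt_trans; rewrite le_eqVlt.
  apply/orP; left; apply/eqP; apply: eq_integral => x _ /=.
  by rewrite normrM (gtr0_norm (gauss_gt0 x)).
split => //.
rewrite [LHS]integralE [RHS]integralE !ge0_integral_normal_prob//; last 2 first.
- exact: measurable_funeneg.
- exact: measurable_funepos.
congr (_ - _)%E; apply: eq_integral => x _ /=.
- rewrite !funeposE /= -!EFin_max -EFinM; congr EFin.
  by rewrite -[in RHS](mul0r (gauss x)) maxr_pMl ?ltW// gauss_gt0.
- rewrite !funenegE /= -!EFin_max -EFinM; congr EFin.
  by rewrite -[in RHS](mul0r (gauss x)) -mulNr maxr_pMl ?ltW// gauss_gt0.
Qed.

(** The density of variance 2 exceeds [gauss], up to a constant, by the factor [expR (x^2 / 4)],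
    which absorbs the linear factor. Integrability then comes from that of a normal density. *)
Lemma linear_gauss_le x : (`|x| + 1) * gauss x <=
  2 * normal_peak 1 / normal_peak (Num.sqrt 2) * normal_pdf 0 (Num.sqrt 2) x.
Proof.
have s2 : Num.sqrt 2 != 0 :> R by rewrite gt_eqF// sqrtr_gt0.
have p1 : 0 < normal_peak (1 : R) by rewrite normal_peak_gt0// oner_eq0.
have p2 : 0 < normal_peak (Num.sqrt 2 : R) by rewrite normal_peak_gt0.
rewrite gaussE normal_pdfE//.
rewrite [leRHS](_ : _ = normal_peak 1 * (2 * normal_fun 0 (Num.sqrt 2) x)); last first.
  by field; rewrite gt_eqF.
rewrite mulrCA ler_pM2l//.
rewrite /normal_fun subr0 sqr_sqrtr//.
set e := expR (- x ^+ 2 / (2 *+ 2)).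
have -> : expR (- x ^+ 2 / 2) = e * e.
  by rewrite /e -expRD; congr expR; rewrite -mulr_natl; field.
rewrite mulrA ler_pM2r ?expR_gt0// /e mulNr expRN ler_pdivrMr ?expR_gt0//.
have e1 := expR_ge1Dx (x ^+ 2 / (2 *+ 2)).
have : `|x| * `|x| = x ^+ 2 by rewrite -expr2 real_normK ?num_real.
have := sqr_ge0 x; have := sqr_ge0 (`|x| - 2); rewrite !expr2.
move: e1; rewrite -?expr2; have -> : x ^+ 2 / (2 *+ 2) = x ^+ 2 / 4 by rewrite -mulrnA.
set E := expR _; set y := `|x|; set z := x * x; nra.
Qed.

Lemma integrable_linear_gauss k a b : continuous k ->
  (forall x, `|k x| <= a * `|x| + b) ->
  mu.-integrable setT (fun x => (k x * gauss x)%:E).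
Proof.
move=> ck kab.
have mk : measurable_fun [set: R] k by exact: continuous_measurable_fun.
pose c := Num.max a b.
pose K := c * (2 * normal_peak 1 / normal_peak (Num.sqrt 2)) : R.
apply: (@le_integrable _ _ _ mu setT measurableT _
  (fun x => K%:E * (normal_pdf 0 (Num.sqrt 2) x)%:E)%E).
- by apply/measurable_EFinP/measurable_funM => //; exact: measurable_normal_pdf.
- move=> x _; rewrite -EFinM /= lee_fin normrM (gtr0_norm (gauss_gt0 x)).
  apply: le_trans (ler_norm _).
  have c0 : 0 <= c.
    rewrite /c le_max; have := le_trans (normr_ge0 _) (kab 0).
    by rewrite normr0 mulr0 add0r => ->; rewrite orbT.
  rewrite /K -(mulrA c); apply: le_trans (ler_wpM2l c0 (linear_gauss_le x)).
  rewrite mulrA ler_pM2r ?gauss_gt0//; apply: le_trans (kab x) _.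
  by rewrite mulrDr mulr1 lerD ?ler_wpM2r// le_max lexx ?orbT.
- by apply: integrableZl => //; exact: integrable_normal_pdf.
Qed.

Lemma gauss_tail x : 1 <= x ->
  (\int[mu]_(t in `[x, +oo[) (t * gauss t)%:E = (gauss x)%:E)%E.
Proof.
move=> x1.
have dG (t : R) : is_derive t 1 (- @gauss R) (t * gauss t).
  have dg := is_derive_gauss t.
  by apply: is_derive_eq; rewrite mulNr opprK.
have cG : continuous (- @gauss R) by exact: is_derive1_continuous dG.
rewrite (@ge0_continuous_FTC2y _ _ (- @gauss R) _ 0)//.
- by rewrite -EFinB sub0r opprK.
- by move=> t xt; rewrite mulr_ge0 ?ltW ?gauss_gt0//; lra.
- apply: continuous_subspaceT => t; apply: cvgM; first exact: cvg_id.
  exact: continuous_gauss.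
- rewrite -oppr0; apply: cvgN; apply/cvgrPdist_le => e e0.
  have [|M HM] := @linear_growth_gauss_lim R (cst 1) 1 0 ler01 (lexx _) _ e e0.
    by move=> t _; rewrite normr1 mul0r addr0.
  near=> t; rewrite sub0r normrN.
  rewrite gtr0_norm ?gauss_gt0//.
  have := HM t; rewrite normr1 mul1r; apply.
  by apply: le_trans (ler_norm _); near: t; apply: nbhs_pinfty_ge; exact: num_real.
- by apply: cvg_at_right_filter; exact: cG.
- by move=> t _; rewrite derive1E; have [_ ->] := dG t.
Unshelve. all: by end_near. Qed.

Lemma linear_gauss_tail k a b x : 0 <= a -> 0 <= b -> continuous k ->
  (forall x, `|k x| <= a * `|x| + b) -> 1 <= x ->
  `|\int[mu]_(t in `[x, +oo[) (k t * gauss t)| <= (a + b) * gauss x.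
Proof.
move=> a0 b0 ck kab x1.
have kI := integrable_linear_gauss ck kab.
have sI A : measurable A -> mu.-integrable A (fun x => (k x * gauss x)%:E).
  by move=> mA; apply: integrableS kI.
apply: le_trans (le_normr_Rintegral _ (sI _ _)) _ => //.
have idI : mu.-integrable setT (fun x : R => (x * gauss x)%:E).
  apply: (@integrable_linear_gauss id 1 0); first by move=> t; exact: cvg_id.
  by move=> t; rewrite mul1r addr0.
have -> : (a + b) * gauss x =
    \int[mu]_(t in `[x, +oo[) ((a + b) * (t * gauss t)).
  rewrite RintegralZl//; last exact: integrableS idI.
  by rewrite /Rintegral gauss_tail.
apply: le_Rintegral => //.
- exact: (integrable_norm (sI _ _)).
- have := @integrableZl _ _ _ mu `[x, +oo[ _ (a + b)
    (fun t : R => (t * gauss t)%:E).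
  by apply => //; exact: integrableS idI.
- move=> t /=; rewrite in_itv/= andbT => xt.
  rewrite normrM (gtr0_norm (gauss_gt0 t)) mulrA ler_pM2r ?gauss_gt0//.
  have t1 := le_trans x1 xt.
  apply: le_trans (kab t) _; rewrite ger0_norm; last lra.
  by rewrite mulrDl lerD2l ler_peMr.
Qed.

End GaussianIntegral.

(** * Solutions of Stein's equation with a Lipschitz derivative *)

Section SteinEquation.
Variable R : realType.
Implicit Types (h k : R -> R) (a b x : R).
Local Notation mu := (@lebesgue_measure R).

(** The solution is the primitive of [k * gauss] from minus infinity, divided by [gauss]. As the
    total integral vanishes, that primitive is also minus the right tail, so it is comparable to
    [gauss] on both sides. These tail estimates hold only for [|x| >= 1]; they supply the decay that
    [barrier] asks for, and [barrier] gives the bound everywhere. *)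
Lemma stein_equation k a b : 0 <= a -> 0 <= b -> continuous k ->
  (forall x, `|k x| <= a * `|x| + b) ->
  \int[mu]_x (k x * gauss x) = 0 ->
  exists2 f : R -> R, (forall x, is_derive x 1 f (x * f x + k x)) &
    forall x, `|f x| <= a + 2 * b.
Proof.
move=> a0 b0 ck kab k0.
have kI := integrable_linear_gauss ck kab.
have sI A : measurable A -> mu.-integrable A (fun x => (k x * gauss x)%:E).
  by move=> mA; apply: integrableS kI.
have ckg : continuous (fun x => k x * gauss x).
  by move=> x; apply: cvgM; [exact: ck|exact: continuous_gauss].
pose F x := \int[mu]_(t in `]-oo, x]) (k t * gauss t).
have dF (x : R) : is_derive x 1 F (k x * gauss x).
  have [] := @continuous_FTC1 R (fun x => k x * gauss x) -oo%O x (x + 1).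
  - by rewrite ltrDl.
  - exact: sI.
  - by rewrite ltNyr.
  - exact: ckg.
  rewrite -/F => /derivableP dFx; rewrite derive1E => Fx.
  by rewrite -Fx.
pose f x := F x / gauss x.
have df (x : R) : is_derive x 1 f (x * f x + k x).
  have g0 : gauss x != 0 by rewrite gt_eqF// gauss_gt0.
  have d1 := @is_deriveV _ _ _ _ _ g0 (is_derive_gauss x).
  apply: (is_derive_eq (is_deriveM (dF x) d1)).
  rewrite /GRing.scale /= /f; field.
  exact: g0.
have F_right x : 1 <= x -> `|F x| <= (a + b) * gauss x.
  move=> x1; have : F x + \int[mu]_(t in `[x, +oo[) (k t * gauss t) = 0.
    rewrite -Rintegral_itv_obnd_cbnd; last exact: sI.
    rewrite -Rintegral_setU//.
    - rewrite -[RHS]k0; congr (Rintegral _ _ _).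
      by rewrite -setCitvl setUv.
    - by apply: sI; exact: measurableU.
    - by apply/disj_setPS => t []; rewrite /= !in_itv/= andbT => xt /(le_lt_trans xt); rewrite ltxx.
  move/eqP; rewrite addr_eq0 => /eqP ->; rewrite normrN.
  exact: linear_gauss_tail.
have F_left x : x <= -1 -> `|F x| <= (a + b) * gauss x.
  move=> x1; apply: le_trans (le_normr_Rintegral _ (sI _ _)) _ => //.
  have ck' : continuous (fun t => `|k (- t)|).
    move=> t; apply: cvg_norm; apply: (cvg_comp (fun t => - t) k); last exact: ck.
    exact: cvgN.
  have -> : \int[mu]_(t in `]-oo, x]) `|k t * gauss t| =
      \int[mu]_(t in `[- x, +oo[) (`|k (- t)| * gauss t).
    rewrite /Rintegral; congr fine.
    rewrite -{1}(opprK x) ge0_integration_by_substitutionNy//.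
    - apply: eq_integral => t _ /=.
      by rewrite normrM gaussN (gtr0_norm (gauss_gt0 t)).
    - by apply: continuous_subspaceT => t; apply: cvg_norm; exact: ckg.
  rewrite -gaussN; apply: le_trans (ler_norm _) _.
  apply: linear_gauss_tail => //; last lra.
  by move=> t; rewrite normr_id -(normrN t).
have f_out x : 1 <= `|x| -> `|f x| <= a + b.
  rewrite ler_normr => x1; rewrite /f normrM normfV (gtr0_norm (gauss_gt0 x)).
  rewrite ler_pdivrMr ?gauss_gt0//.
  by case/orP: x1 => x1; [exact: F_right|apply: F_left; lra].
exists f => //; apply: (barrier a0 b0 df kab).
apply: (@linear_growth_gauss_lim _ _ (a + b) 0) => //; first exact: addr_ge0.
by move=> x /f_out; rewrite mul0r addr0.
Qed.

Definition gaussian_mean h := \int[mu]_x (h x * gauss x).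

Definition gaussian_abs_moment := gaussian_mean (fun x => `|x|).

(** Three uses of [barrier] in a row: with [B] the absolute moment, [|f| <= C0 = 1 + 2 B], then
    [|f'| <= C1 = 2 (C0 + 1)], then [|f + x f'| <= 1 + 4 C1]. Adding [|h'| <= 1] bounds [f'']. *)
Definition stein_constant := 2 + 4 * (2 * (1 + 2 * gaussian_abs_moment + 1)).

Lemma gaussian_abs_moment_ge0 : 0 <= gaussian_abs_moment.
Proof. by apply: Rintegral_ge0 => x _; rewrite mulr_ge0// ltW// gauss_gt0. Qed.

Lemma stein_constant_ge0 : 0 <= stein_constant.
Proof. by rewrite /stein_constant; have := gaussian_abs_moment_ge0; lra. Qed.

Lemma integrable_gauss : mu.-integrable setT (fun x => (gauss x)%:E).
Proof. exact: integrable_normal_pdf. Qed.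

Lemma Rintegral_gauss : \int[mu]_x gauss x = 1.
Proof. by rewrite /Rintegral integral_normal_pdf. Qed.

Lemma integrable_abs_gauss : mu.-integrable setT (fun x : R => (`|x| * gauss x)%:E).
Proof.
apply: (@integrable_linear_gauss _ (fun x => `|x|) 1 0).
  by move=> x; apply: cvg_norm; exact: cvg_id.
by move=> x; rewrite mul1r addr0 normr_id.
Qed.

Lemma integrable_lipschitz_gauss h K : continuous h ->
  (forall x y, `|h y - h x| <= K * `|y - x|) ->
  mu.-integrable setT (fun x => (h x * gauss x)%:E).
Proof.
move=> ch hK; apply: (@integrable_linear_gauss _ h K `|h 0|) => // x.
have := hK 0 x; rewrite subr0 => hx.
have -> : h x = (h x - h 0) + h 0 by rewrite subrK.
by apply: le_trans (ler_normD _ _) _; rewrite lerD2r.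
Qed.

Lemma dist_gaussian_mean h x : continuous h ->
  (forall x y, `|h y - h x| <= `|y - x|) ->
  `|h x - gaussian_mean h| <= `|x| + gaussian_abs_moment.
Proof.
move=> ch h1.
have hI : mu.-integrable setT (fun x => (h x * gauss x)%:E).
  by apply: (@integrable_lipschitz_gauss h 1) => // *; rewrite mul1r.
have cI (c : R) : mu.-integrable setT (fun x => (c * gauss x)%:E).
  exact: (@integrableZl _ _ _ mu setT measurableT c _ integrable_gauss).
have -> : h x - gaussian_mean h = \int[mu]_t ((h x - h t) * gauss t).
  under [RHS]eq_Rintegral do rewrite mulrBl.
  rewrite (RintegralB measurableT (cI (h x)) hI) (RintegralZl _ measurableT integrable_gauss).
  by rewrite Rintegral_gauss mulr1.
have bI : mu.-integrable setT (fun t => ((h x - h t) * gauss t)%:E).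
  apply: eq_integrable (integrableB measurableT (cI (h x)) hI) => //.
  by move=> t _; rewrite /= -EFinB -mulrBl.
apply: le_trans (le_normr_Rintegral measurableT bI) _.
have -> : `|x| + gaussian_abs_moment = \int[mu]_t (`|x| * gauss t + `|t| * gauss t).
  rewrite (RintegralD measurableT (cI _) integrable_abs_gauss).
  by rewrite (RintegralZl _ measurableT integrable_gauss) Rintegral_gauss mulr1.
apply: le_Rintegral => //.
- exact: (integrable_norm bI).
- exact: (integrableD measurableT (cI _) integrable_abs_gauss).
- move=> t _; rewrite normrM (gtr0_norm (gauss_gt0 t)) -mulrDl.
  rewrite ler_pM2r ?gauss_gt0//; apply: le_trans (h1 _ _) _.
  exact: ler_normB.
Qed.

(* The solution [f], its derivative [f'] and [f + x f'], which is [f'' - h'], all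
   solve an equation [g' = x g + k] with [k] of linear growth. *)
Lemma stein_solution_C1 h dh : (forall x, is_derive x 1 h (dh x)) ->
  (forall x, `|dh x| <= 1) ->
  exists f df, [/\ forall x, is_derive x 1 f (df x),
    forall x, df x = x * f x + (h x - gaussian_mean h) &
    forall x y, `|df y - df x| <= stein_constant * `|y - x|].
Proof.
move=> hdh dh1.
set B := gaussian_abs_moment; have B0 : 0 <= B := gaussian_abs_moment_ge0.
have h1 (x y : R) : `|h y - h x| <= `|y - x|.
  by rewrite -[leRHS]mul1r; exact: is_derive1_lipschitz hdh dh1 x y.
have ch : continuous h := is_derive1_continuous hdh.
pose k x := h x - gaussian_mean h.
have kB x : `|k x| <= 1 * `|x| + B by rewrite mul1r; exact: dist_gaussian_mean.
have dk (x : R) : is_derive x 1 k (dh x).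
  have := hdh x => dhx.
  by apply: is_derive_eq; rewrite subr0.
have ck : continuous k := is_derive1_continuous dk.
have k0 : \int[mu]_x (k x * gauss x) = 0.
  under eq_Rintegral do rewrite mulrBl.
  have hI : mu.-integrable setT (fun x => (h x * gauss x)%:E).
    by apply: (@integrable_lipschitz_gauss h 1) => // *; rewrite mul1r.
  have cI : mu.-integrable setT (fun x => (gaussian_mean h * gauss x)%:E).
    exact: (@integrableZl _ _ _ mu setT measurableT _ _ integrable_gauss).
  rewrite (RintegralB measurableT hI cI) (RintegralZl _ measurableT integrable_gauss).
  by rewrite Rintegral_gauss mulr1 subrr.
have [f df fB] := stein_equation ler01 B0 ck kB k0.
set C0 := 1 + 2 * B in fB.
have C00 : 0 <= C0 by rewrite /C0; lra.
pose f1 x := x * f x + k x.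
have df1 (x : R) : is_derive x 1 f1 (x * f1 x + (f x + dh x)).
  have d1 := is_deriveD (is_deriveM (is_derive_id x 1) (df x)) (dk x).
  apply: (is_derive_eq d1).
  by rewrite /GRing.scale /= /f1; ring.
have f1B x : `|f1 x| <= 0 + 2 * (C0 + 1).
  apply: (barrier (lexx 0) _ df1) => //; first lra.
    move=> y; rewrite mul0r add0r; apply: le_trans (ler_normD _ _) _.
    by rewrite lerD.
  (* The equation itself gives this crude linear bound on [f1]; it only serves as the decay
     condition, and the barrier replaces it by a constant. *)
  apply: (@linear_growth_gauss_lim _ _ B (C0 + 1)) => //; first lra.
  move=> y _; apply: le_trans (ler_normD _ _) _; rewrite normrM.
  have := ler_wpM2l (normr_ge0 y) (fB y); have := kB y; rewrite mulrDl.
  lra.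
rewrite add0r in f1B; set C1 := 2 * (C0 + 1) in f1B.
pose v x := f x + x * f1 x.
have dv (x : R) : is_derive x 1 v (x * v x + (2 * f1 x + x * dh x)).
  have d1 := is_deriveD (df x) (is_deriveM (is_derive_id x 1) (df1 x)).
  apply: (is_derive_eq d1).
  by rewrite /GRing.scale /= /v -/(f1 x); ring.
have vB x : `|v x| <= 1 + 2 * (2 * C1).
  apply: (barrier ler01 _ dv) => //; first by rewrite /C1; lra.
    move=> y; apply: le_trans (ler_normD _ _) _; rewrite !normrM (ger0_norm (ler0n _ 2)).
    have := f1B y; have := ler_wpM2l (normr_ge0 y) (dh1 y); lra.
  apply: (@linear_growth_gauss_lim _ _ C0 C1) => //; first by rewrite /C1; lra.
  move=> y _; apply: le_trans (ler_normD _ _) _; rewrite normrM.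
  by have := ler_wpM2l (normr_ge0 y) (f1B y); have := fB y; lra.
exists f, f1; split => // x y.
apply: (is_derive1_lipschitz df1) => {x y} x.
have -> : x * f1 x + (f x + dh x) = v x + dh x by rewrite /v; ring.
apply: le_trans (ler_normD _ _) _.
by have := vB x; have := dh1 x; rewrite /stein_constant -/B -/C0 -/C1; lra.
Qed.

End SteinEquation.

(** * From differentiable to Lipschitz test functions *)

Section SteinMethod.
Variable R : realType.
Implicit Types x y : R.
Local Notation mu := (@lebesgue_measure R).

(** The primitive based at 0 needs a sign change on the left of 0. Near [x0] it differs by a
    constant from the integral based at [- |x0| - 1], to which the fundamental theorem of calculus
    applies. *)
Lemma continuous_antiderivative (h : R -> R) : continuous h ->
  exists H : R -> R, forall x : R, is_derive x 1 H (h x).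
Proof.
move=> ch.
have hI (u v : R) : mu.-integrable `[u, v] (EFin \o h).
  apply: continuous_compact_integrable; first exact: segment_compact.
  exact: continuous_subspaceT.
pose F (u x : R) := \int[mu]_(t in `[u, x]) h t.
pose H x := if 0 <= x then F 0 x else - F x 0.
exists H => x0.
have nx0 : - `|x0| <= x0 by rewrite lerNl -normrN ler_norm.
have [dF F'] := @continuous_FTC1_closed R h (- `|x0| - 1) x0 (x0 + 1)
   ltac:(by rewrite ltrDl) (hI _ _)
   ltac:(lra) (ch x0).
rewrite -[fun x => _]/(F (- `|x0| - 1)) in dF F'.
have dFx : is_derive x0 1 (F (- `|x0| - 1)) (h x0).
  by rewrite -F' derive1E; exact: derivableP.
have FB (u v w : R) : u <= v -> v <= w -> F u w - F u v = F v w.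
  move=> uv vw; rewrite /F Rintegral_itvB ?bnd_simp//.
  apply: Rintegral_itv_obnd_cbnd.
  apply: integrableS (hI v w) => //.
  by apply: subset_itvr; rewrite bnd_simp.
apply: (@near_eq_is_derive _ _ _ (fun x => F (- `|x0| - 1) x - F (- `|x0| - 1) 0)); last first.
  have c0 := is_derive_cst (F (- `|x0| - 1) 0) x0 1.
  by apply: (is_derive_eq (is_deriveB dFx c0)); rewrite subr0.
near=> x.
have xl : - `|x0| - 1 <= x.
  have : x \in `]x0 - 1, +oo[.
    by near: x; apply: near_in_itvoy; rewrite in_itv/= andbT; lra.
  rewrite in_itv/= andbT; lra.
have n0 := normr_ge0 x0.
rewrite /H; case: ifPn => [x_ge0|]; first by apply: FB => //; lra.
rewrite -ltNge => x_lt0; rewrite -(FB (- `|x0| - 1) x 0)// ?opprB//.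
exact: ltW.
Unshelve. all: by end_near. Qed.

Lemma lipschitz1P (h : R -> R) : 1.-lipschitz (h : R^o -> R^o) ->
  forall x y, `|h y - h x| <= `|y - x|.
Proof. by move=> hl x y; have /= := hl (y, x) (conj I I); rewrite mul1r. Qed.

Lemma lipschitz1_continuous (h : R -> R) :
  (forall x y, `|h y - h x| <= `|y - x|) -> continuous h.
Proof.
move=> h1 x; apply/cvgrPdist_le => e e0; near=> y.
apply: le_trans (h1 _ _) _; near: y.
exact: (@cvgr_dist_le _ _ _ (nbhs x) _ id x).
Unshelve. all: by end_near. Qed.

(** The smoothing is the average of [h] over [[x, x + e]]: its derivative is a difference quotient
    of [h], and its value is a value of [h] within distance [e] of [x]. *)
Lemma lipschitz1_smoothing (h : R -> R) (e : R) : 0 < e ->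
  (forall x y, `|h y - h x| <= `|y - x|) ->
  exists g dg : R -> R, [/\ forall x : R, is_derive x 1 g (dg x),
    forall x, `|dg x| <= 1 & forall x, `|g x - h x| <= e].
Proof.
move=> e0 h1; have ch := lipschitz1_continuous h1.
have [H dH] := continuous_antiderivative ch.
exists (fun x => e^-1 * (H (x + e) - H x)), (fun x => e^-1 * (h (x + e) - h x)).
split=> x.
- have dHe : is_derive x 1 (fun y => H (y + e)) (h (x + e)).
    have de : is_derive x 1 (fun y : R => y + e) 1.
      by apply: is_derive_eq; rewrite addr0.
    have dHx := dH (x + e).
    have d1 := @is_derive1_comp _ H (fun y => y + e) x _ _ dHx de.
    by rewrite mulr1 in d1.
  by have := is_deriveZ e^-1 (is_deriveB dHe (dH x)).
- rewrite normrM normfV (gtr0_norm e0) ler_pdivrMl// mulr1.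
  apply: le_trans (h1 _ _) _; rewrite addrAC subrr add0r gtr0_norm//.
- have [|c /andP[xc ce] ->] := MVT_global dH (_ : x < x + e); first by rewrite ltrDl.
  rewrite addrAC subrr add0r mulrCA mulVf ?gt_eqF// mulr1.
  by apply: le_trans (h1 _ _) _; rewrite gtr0_norm; lra.
Qed.

Lemma dist_gaussian_mean_le (g h : R -> R) (e : R) :
  (forall x y, `|g y - g x| <= `|y - x|) ->
  (forall x y, `|h y - h x| <= `|y - x|) ->
  (forall x, `|g x - h x| <= e) ->
  `|gaussian_mean g - gaussian_mean h| <= e.
Proof.
move=> g1 h1 gh.
have I (k : R -> R) : (forall x y, `|k y - k x| <= `|y - x|) ->
    mu.-integrable setT (fun x => (k x * gauss x)%:E).
  move=> k1; apply: (@integrable_lipschitz_gauss _ k 1).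
    exact: lipschitz1_continuous.
  by move=> x y; rewrite mul1r.
rewrite /gaussian_mean -(RintegralB measurableT (I _ g1) (I _ h1)).
have ghI := integrableB measurableT (I _ g1) (I _ h1).
apply: le_trans (le_normr_Rintegral measurableT ghI) _.
have -> : e = \int[mu]_x (e * gauss x).
  by rewrite (RintegralZl _ measurableT (@integrable_gauss R)) Rintegral_gauss mulr1.
apply: le_Rintegral => //.
- exact: (integrable_norm ghI).
- exact: (@integrableZl _ _ _ mu setT measurableT _ _ (@integrable_gauss R)).
- move=> x _; rewrite -mulrBl normrM (gtr0_norm (gauss_gt0 x)).
  by rewrite ler_pM2r ?gauss_gt0.
Qed.

(** The hypothesis covers all [f] with a fixed Lipschitz constant for [df], so [K] is the same for
    every smoothing of [h]. Each of the two means moves by at most [e / 2], and [e] is arbitrary. *)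
Lemma stein_method (Omega : finType) (P W : Omega -> R) (K : R) :
  (forall w, 0 <= P w) -> \sum_w P w = 1 ->
  (forall f df : R -> R, (forall x : R, is_derive x 1 f (df x)) ->
    (forall x y, `|df y - df x| <= stein_constant R * `|y - x|) ->
    `|\sum_w P w * (df (W w) - W w * f (W w))| <= K) ->
  forall h : R -> R, (forall x y, `|h y - h x| <= `|y - x|) ->
  `|\sum_w P w * h (W w) - gaussian_mean h| <= K.
Proof.
move=> P0 P1 HK h h1; apply/ler_addgt0Pr => e e0.
have [|g [dg [dgE dg1 gh]]] := @lipschitz1_smoothing h (e / 2) _ h1.
  by rewrite divr_gt0.
have g1 (x y : R) : `|g y - g x| <= `|y - x|.
  by rewrite -[leRHS]mul1r; exact: is_derive1_lipschitz dgE dg1 x y.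
have [f [df [dfE dfeq dfL]]] := stein_solution_C1 dgE dg1.
have Kg : `|\sum_w P w * g (W w) - gaussian_mean g| <= K.
  have := HK f df dfE dfL; congr (`| _ | <= _).
  rewrite -[gaussian_mean g]mul1r -P1 mulr_suml -sumrB; apply: eq_bigr => w _.
  by rewrite dfeq; ring.
have Pgh : `|\sum_w P w * h (W w) - \sum_w P w * g (W w)| <= e / 2.
  rewrite -sumrB; apply: le_trans (ler_norm_sum _ _ _) _.
  move: (e / 2) gh => e' gh; rewrite -[leRHS]mul1r -P1 mulr_suml; apply: ler_sum => w _.
  by rewrite -mulrBr normrM (ger0_norm (P0 w)) ler_wpM2l// distrC; exact: gh.
have Mgh := dist_gaussian_mean_le g1 h1 gh.
move: Kg Pgh Mgh; rewrite !ler_norml.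
by move=> /andP[? ?] /andP[? ?] /andP[? ?]; apply/andP; split; lra.
Qed.

Lemma expectation_normal_prob (h : R -> R) :
  (forall x y, `|h y - h x| <= `|y - x|) ->
  ('E_(normal_prob (0 : R) 1)[h \o (fun x : R => x)] = (gaussian_mean h)%:E)%E.
Proof.
move=> h1; have ch := lipschitz1_continuous h1.
have hI : mu.-integrable setT (fun x => (h x * gauss x)%:E).
  by apply: (@integrable_lipschitz_gauss _ h 1) => // x y; rewrite mul1r.
have [|_ E] := integral_normal_prob hI; first exact: continuous_measurable_fun.
rewrite unlock /= E /gaussian_mean /Rintegral fineK//.
exact: integrable_fin_num.
Qed.

End SteinMethod.

(** * Local dependence on finite product spaces *)

Section ProductSpace.
Variables (R : realType) (I C : finType) (p : C -> R).
Hypotheses (p_ge0 : forall b, 0 <= p b) (p_sum1 : \sum_b p b = 1).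
Local Notation Omega := {ffun I -> C}.
Implicit Types (X Y : Omega -> R) (S : {set I}) (w : Omega).

Definition prod_weight w : R := \prod_i p (w i).

(** Expectation under the product law, kept as a finite sum so that no integrability condition
    arises. *)
Definition ex X : R := \sum_w prod_weight w * X w.

Lemma prod_weight_ge0 w : 0 <= prod_weight w.
Proof. by apply: prodr_ge0 => i _. Qed.

Lemma ex_prod (F : I -> C -> R) :
  ex (fun w => \prod_i F i (w i)) = \prod_i \sum_b p b * F i b.
Proof.
rewrite bigA_distr_bigA; apply: eq_bigr => w _.
by rewrite -big_split.
Qed.

Lemma prod_weight_sum1 : \sum_w prod_weight w = 1.
Proof.
transitivity (ex (fun=> \prod_(i : I) 1)).
  by apply: eq_bigr => w _; rewrite big1// mulr1.
rewrite (ex_prod (fun _ _ => 1)) big1// => i _.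
by rewrite -[RHS]p_sum1; apply: eq_bigr => b _; rewrite mulr1.
Qed.

Lemma eq_ex X Y : X =1 Y -> ex X = ex Y.
Proof. by move=> XY; apply: eq_bigr => w _; rewrite XY. Qed.

Lemma ex_cst (a : R) : ex (fun=> a) = a.
Proof. by rewrite /ex -mulr_suml prod_weight_sum1 mul1r. Qed.

Lemma exD X Y : ex (fun w => X w + Y w) = ex X + ex Y.
Proof. by rewrite -big_split; apply: eq_bigr => w _; rewrite mulrDr. Qed.

Lemma exZ (a : R) X : ex (fun w => a * X w) = a * ex X.
Proof. by rewrite /ex mulr_sumr; apply: eq_bigr => w _; rewrite mulrCA. Qed.

Lemma exB X Y : ex (fun w => X w - Y w) = ex X - ex Y.
Proof. by rewrite -sumrB; apply: eq_bigr => w _; rewrite mulrBr. Qed.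

Lemma ex_sum (A : finType) (Q : pred A) (X : A -> Omega -> R) :
  ex (fun w => \sum_(i | Q i) X i w) = \sum_(i | Q i) ex (X i).
Proof. by rewrite exchange_big; apply: eq_bigr => w _; rewrite mulr_sumr. Qed.

Lemma le_ex X Y : (forall w, X w <= Y w) -> ex X <= ex Y.
Proof.
by move=> XY; apply: ler_sum => w _; rewrite ler_wpM2l// prod_weight_ge0.
Qed.

Lemma ex_ge0 X : (forall w, 0 <= X w) -> 0 <= ex X.
Proof. by move=> X0; apply: sumr_ge0 => w _; rewrite mulr_ge0// prod_weight_ge0. Qed.

Lemma ler_norm_ex X : `|ex X| <= ex (fun w => `|X w|).
Proof.
apply: le_trans (ler_norm_sum _ _ _) _; apply: ler_sum => w _.
by rewrite normrM (ger0_norm (prod_weight_ge0 w)).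
Qed.

Definition depends_on S X :=
  forall w w', (forall i, i \in S -> w i = w' i) -> X w = X w'.

Lemma depends_onS S S' X : S \subset S' -> depends_on S X -> depends_on S' X.
Proof. by move=> /fintype.subsetP SS' dX w w' h; apply: dX => i /SS'; exact: h. Qed.

Lemma depends_on_comp S X (f : R -> R) : depends_on S X ->
  depends_on S (fun w => f (X w)).
Proof. by move=> dX w w' h; rewrite (dX w w' h). Qed.

Lemma depends_on_sum S (A : finType) (Q : pred A) (X : A -> Omega -> R) :
  (forall i, Q i -> depends_on S (X i)) ->
  depends_on S (fun w => \sum_(i | Q i) X i w).
Proof. by move=> dX w w' h; apply: eq_bigr => i /dX; exact. Qed.

Lemma depends_onM S X Y : depends_on S X -> depends_on S Y ->
  depends_on S (fun w => X w * Y w).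
Proof. by move=> dX dY w w' h; rewrite (dX w w' h) (dY w w' h). Qed.

(* Exchanging the coordinates in [S] of two independent copies of the random
   point preserves their joint law. *)
Lemma ex_indep S S' X Y : [disjoint S & S']%B -> depends_on S X ->
  depends_on S' Y -> ex (fun w => X w * Y w) = ex X * ex Y.
Proof.
move=> dSS' dX dY.
pose mix (u : Omega * Omega) : Omega * Omega :=
  ([ffun i => if i \in S then u.1 i else u.2 i],
   [ffun i => if i \in S then u.2 i else u.1 i]).
have mixK : involutive mix.
  by move=> [w w']; rewrite /mix /=; congr (_, _); apply/ffunP => i;
    rewrite !ffunE; case: ifP => iS; rewrite ?ffunE ?iS.
rewrite [RHS]big_distrlr /= pair_big /= (reindex mix) /=; last first.
  by exists mix => u _; rewrite mixK.
rewrite -[LHS]mulr1 -prod_weight_sum1 [LHS]big_distrlr /= pair_big /=.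
apply: eq_bigr => -[w w'] _ /=.
have -> : X [ffun i => if i \in S then w i else w' i] = X w.
  by apply: dX => i iS; rewrite ffunE iS.
have -> : Y [ffun i => if i \in S then w' i else w i] = Y w.
  by apply: dY => i iS'; rewrite ffunE (disjointFl dSS' iS').
have : prod_weight w * prod_weight w' =
    prod_weight [ffun i => if i \in S then w i else w' i] *
    prod_weight [ffun i => if i \in S then w' i else w i].
  rewrite /prod_weight -!big_split; apply: eq_bigr => i _ /=.
  by rewrite !ffunE; case: ifP => // _; rewrite mulrC.
set a := prod_weight w; set b := prod_weight w'; move=> E.
by rewrite mulrAC E; ring.
Qed.

Section LocalDependence.
Variables (A : finType) (supp : A -> {set I}) (Y : A -> Omega -> R).
Hypothesis Y_dep : forall i, depends_on (supp i) (Y i).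
Hypothesis Y_mean : forall i, ex (Y i) = 0.

Definition meets (i j : A) := ~~ [disjoint supp i & supp j]%B.

Let W w := \sum_i Y i w.

Hypothesis W_var : ex (fun w => W w ^+ 2) = 1.

Variables (f df : R -> R) (L : R).
Hypothesis L_ge0 : 0 <= L.
Hypothesis f_taylor :
  forall x y, `|f y - f x - (y - x) * df x| <= L * (y - x) ^+ 2.
Hypothesis df_lip : forall x y, `|df y - df x| <= L * `|y - x|.

(** [Wi i] is independent of [Y i], and [Wij i j] of the product [Y i * Y j]; [Zi i] is the part of
    [W] that is removed first. *)
Let Wi i w := \sum_(j | ~~ meets i j) Y j w.
Let Wij i j w := \sum_(k | ~~ (meets i k || meets j k)) Y k w.
Let Zi i w := \sum_(j | meets i j) Y j w.

Let W_split i w : W w = Zi i w + Wi i w.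
Proof. by rewrite /W (bigID (meets i)). Qed.

Let ex_indep_rest S (U : pred A) X (g : R -> R) : depends_on S X ->
  (forall k, U k -> [disjoint S & supp k]%B) ->
  ex (fun w => X w * g (\sum_(k | U k) Y k w)) =
  ex X * ex (fun w => g (\sum_(k | U k) Y k w)).
Proof.
move=> dX dU; apply: (@ex_indep S (\bigcup_(k | U k) supp k)%SET) => //.
  exact: finset.bigcup_disjoint.
apply: (@depends_on_comp _ (fun w => \sum_(k | U k) Y k w)).
apply: depends_on_sum => k Uk. apply: (depends_onS _ (@Y_dep k)).
exact: (@finset.bigcup_sup _ _ k).
Qed.

Let cov0 i j : ~~ meets i j -> ex (fun w => Y i w * Y j w) = 0.
Proof.
by rewrite negbK => ij; rewrite (ex_indep ij (@Y_dep i) (@Y_dep j)) Y_mean mul0r.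
Qed.

(** Only meeting pairs are correlated, so they carry the whole variance. This identity produces the
    term [E (f'(W))] that has to cancel. *)
Let sum_cov : \sum_i \sum_(j | meets i j) ex (fun w => Y i w * Y j w) = 1.
Proof.
rewrite -W_var (eq_ex (Y := fun w => \sum_i \sum_j Y i w * Y j w)); last first.
  by move=> w; rewrite expr2 big_distrlr.
rewrite ex_sum; apply: eq_bigr => i _; rewrite ex_sum [RHS](bigID (meets i))/=.
by rewrite [X in _ = _ + X]big1 ?addr0// => j /cov0.
Qed.

Let T i j k := ex (fun w => `|Y i w * Y j w * Y k w|).
Let T' i j k := ex (fun w => `|Y i w * Y j w|) * ex (fun w => `|Y k w|).

Let step1 i : `|ex (fun w => Y i w * (f (W w) - f (Wi i w) - Zi i w * df (Wi i w)))|
  <= L * \sum_(j | meets i j) \sum_(k | meets i k) T i j k.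
Proof.
apply: le_trans (ler_norm_ex _) _.
have -> : \sum_(j | meets i j) \sum_(k | meets i k) T i j k =
    ex (fun w => \sum_(j | meets i j) \sum_(k | meets i k) `|Y i w * Y j w * Y k w|).
  by rewrite ex_sum; apply: eq_bigr => j _; rewrite ex_sum.
rewrite -exZ; apply: le_ex => w; rewrite normrM.
have := f_taylor (Wi i w) (W w); have -> : W w - Wi i w = Zi i w.
  by rewrite (W_split i) addrK.
move=> h; apply: le_trans (ler_wpM2l (normr_ge0 (Y i w)) h) _.
rewrite mulrCA ler_wpM2l//.
have -> : Zi i w ^+ 2 = \sum_(j | meets i j) \sum_(k | meets i k) Y j w * Y k w.
  by rewrite expr2 big_distrlr.
rewrite mulr_sumr; apply: ler_sum => j _; rewrite mulr_sumr; apply: ler_sum => k _.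
by rewrite -mulrA normrM ler_wpM2l// ler_norm.
Qed.

Let step2 i j : meets i j ->
  `|ex (fun w => Y i w * Y j w * (df (Wi i w) - df (Wij i j w)))|
  <= L * \sum_(k | ~~ meets i k && meets j k) T i j k.
Proof.
move=> ij; apply: le_trans (ler_norm_ex _) _.
rewrite -ex_sum -exZ; apply: le_ex => w; rewrite normrM.
apply: le_trans (ler_wpM2l (normr_ge0 _) (df_lip _ _)) _.
rewrite mulrCA ler_wpM2l//.
under eq_bigr do rewrite normrM.
rewrite -mulr_sumr ler_wpM2l//.
have -> : Wi i w - Wij i j w = \sum_(k | ~~ meets i k && meets j k) Y k w.
  rewrite /Wi (bigID (meets j)) /= /Wij.
  by under [X in _ - X]eq_bigl do rewrite negb_or; rewrite addrK.
exact: ler_norm_sum.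
Qed.

(** The expectation factors before [df (Wij i j)] is replaced by [df W], so the error involves
    [|Y k|] through a separate mean: this is where [T'] comes from. *)
Let step3 i j : meets i j ->
  `|ex (fun w => Y i w * Y j w * df (Wij i j w)) -
    ex (fun w => Y i w * Y j w) * ex (fun w => df (W w))|
  <= L * \sum_(k | meets i k || meets j k) T' i j k.
Proof.
move=> ij; rewrite /Wij (@ex_indep_rest (supp i :|: supp j)); last 2 first.
- by apply: depends_onM; [apply: (depends_onS _ (@Y_dep i)); exact: finset.subsetUl|
                          apply: (depends_onS _ (@Y_dep j)); exact: finset.subsetUr].
- move=> k; rewrite negb_or !negbK => /andP[ik jk].
  by rewrite -setI_eq0 finset.setIUl finset.setU_eq0 !setI_eq0 ik jk.
rewrite -mulrBr -exB normrM -mulr_sumr mulrCA.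
apply: ler_pM => //; first exact: ler_norm_ex.
apply: le_trans (ler_norm_ex _) _.
rewrite -ex_sum -exZ; apply: le_ex => w.
apply: le_trans (df_lip _ _) _; rewrite ler_wpM2l// distrC.
have -> : W w - \sum_(k | ~~ (meets i k || meets j k)) Y k w =
    \sum_(k | meets i k || meets j k) Y k w.
  by rewrite /W (bigID (fun k => meets i k || meets j k)) /= addrK.
exact: ler_norm_sum.
Qed.

Let indep0 i : ex (fun w => Y i w * f (Wi i w)) = 0.
Proof.
rewrite /Wi (@ex_indep_rest (supp i) _ (Y i)) ?Y_mean ?mul0r//.
by move=> k; rewrite negbK.
Qed.

(** In [E (Y i * f W)], subtracting [E (Y i * f (Wi i)) = 0] and expanding to first order leaves the
    sum over [j] of [E (Y i * Y j * df (Wi i))]. Passing to [Wij i j], factoring, and returning to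
    [W] turns this into covariances times [E (df W)], which [sum_cov] adds up. *)
Lemma local_dependence_bound :
  `|ex (fun w => df (W w) - W w * f (W w))| <=
  L * \sum_i \sum_(j | meets i j) \sum_(k | meets i k || meets j k)
    (T i j k + T' i j k).
Proof.
have -> : ex (fun w => df (W w) - W w * f (W w)) =
  - \sum_i (ex (fun w => Y i w * (f (W w) - f (Wi i w) - Zi i w * df (Wi i w)))
    + \sum_(j | meets i j)
       (ex (fun w => Y i w * Y j w * (df (Wi i w) - df (Wij i j w))) +
       (ex (fun w => Y i w * Y j w * df (Wij i j w)) -
        ex (fun w => Y i w * Y j w) * ex (fun w => df (W w))))).
  rewrite exB -[X in X - _]mul1r -{1}sum_cov.
  rewrite (eq_ex (X := fun w => W w * _) (Y := fun w => \sum_i Y i w * f (W w))); last first.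
    by move=> w; rewrite mulr_suml.
  rewrite ex_sum mulr_suml -opprB; congr (- _); rewrite -sumrB.
  apply: eq_bigr => i _.
  transitivity (ex (fun w => Y i w * f (W w)) - ex (fun w => Y i w * f (Wi i w))
     - ex (fun w => Y i w * (Zi i w * df (Wi i w)))
     + \sum_(j | meets i j) (ex (fun w => Y i w * Y j w * df (Wi i w)) -
        ex (fun w => Y i w * Y j w) * ex (fun w => df (W w)))).
    rewrite indep0 subr0 sumrB -mulr_suml.
    rewrite (eq_ex (X := fun w => Y i w * (Zi i w * df (Wi i w)))
      (Y := fun w => \sum_(j | meets i j) Y i w * Y j w * df (Wi i w))).
      by rewrite ex_sum addrA subrK.
    by move=> w; rewrite /Zi mulr_suml mulr_sumr; apply: eq_bigr => j _; rewrite mulrA.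
  congr (_ + _).
    by rewrite -!exB; apply: eq_ex => w; ring.
  apply: eq_bigr => j _; rewrite addrA; congr (_ - _).
  by rewrite -exD; apply: eq_ex => w; ring.
rewrite normrN; apply: le_trans (ler_norm_sum _ _ _) _.
rewrite mulr_sumr; apply: ler_sum => i _.
apply: le_trans (ler_normD _ _) _.
have -> : L * (\sum_(j | meets i j) \sum_(k | meets i k || meets j k)
    (T i j k + T' i j k)) =
    L * \sum_(j | meets i j) \sum_(k | meets i k) T i j k +
    \sum_(j | meets i j)
      (L * \sum_(k | ~~ meets i k && meets j k) T i j k +
       L * \sum_(k | meets i k || meets j k) T' i j k).
  rewrite !mulr_sumr -big_split; apply: eq_bigr => j _ /=.
  rewrite -!mulrDr; congr (_ * _); rewrite big_split/= addrA; congr (_ + _).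
  rewrite (bigID (meets i))/=; congr (_ + _); apply: eq_bigl => k.
    by case: (meets i k); rewrite ?andbF ?andbT.
  by case: (meets i k); rewrite ?andbF ?andbT.
apply: lerD; first exact: step1.
apply: le_trans (ler_norm_sum _ _ _) _; apply: ler_sum => j ij.
apply: le_trans (ler_normD _ _) _.
by apply: lerD; [exact: step2|exact: step3].
Qed.

End LocalDependence.

End ProductSpace.

(** * Occurrences of a pattern in a random coloring *)

(* [A] indexes the possible occurrences of a pattern: the occurrence [x] takes
   place when each of its points [pos x s] receives the color [col s]. *)
Section PatternCount.
Variables (R : realType) (I C A : finType) (r : nat).
Variables (p : C -> R) (pos : A -> 'I_r -> I) (col : 'I_r -> C).
Hypotheses (p_ge0 : forall b, 0 <= p b) (p_sum1 : \sum_b p b = 1).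
Hypothesis pos_inj : forall x, injective (pos x).
Hypothesis pos_two :
  forall s t, s != t -> injective (fun x => (pos x s, pos x t)).
Local Notation Omega := {ffun I -> C}.
Local Notation E := (ex p).
Local Notation n := #|I|.
Local Notation N := #|A|.
Implicit Types (x : A) (w : Omega) (s t : 'I_r) (S : {set I}).

Definition support x : {set I} := [set pos x s | s : 'I_r]%SET.

(** A partial match forgets the points that may be correlated with another event while keeping
    independent ones. *)
Definition match_on (Q : pred 'I_r) x w : R :=
  \prod_(s | Q s) (w (pos x s) == col s)%:R.

Definition match_ind x w := match_on predT x w.

Definition match_prob : R := \prod_s p (col s).

(** The quotient of [match_prob] by [p (col s)], in a form that stays meaningful when [p (col s)] is
    zero. *)
Definition match_prob_but s : R := \prod_(t | t != s) p (col t).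

Let p_le1 b : p b <= 1.
Proof. by rewrite -p_sum1 (bigD1 b)//= lerDl sumr_ge0. Qed.

Lemma support_mem x s : pos x s \in support x.
Proof. exact: imset_f. Qed.

Lemma card_support x : (#|support x| <= r)%N.
Proof. by rewrite -[leqRHS]card_ord; exact: leq_imset_card. Qed.

Lemma match_on_ge0 Q x w : 0 <= match_on Q x w.
Proof. by apply: prodr_ge0. Qed.

Lemma match_on_le1 Q x w : match_on Q x w <= 1.
Proof. by apply: prodr_ile1 => s _; rewrite ler0n lern1 leq_b1. Qed.

Lemma match_ind_le Q x w : match_ind x w <= match_on Q x w.
Proof.
rewrite /match_ind /match_on (bigID Q)/= ler_piMr//; last first.
  by apply: prodr_ile1 => s _; rewrite ler0n lern1 leq_b1.
exact: match_on_ge0.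
Qed.

Lemma match_ind_sqr x w : match_ind x w * match_ind x w = match_ind x w.
Proof.
by rewrite -big_split; apply: eq_bigr => s _ /=; rewrite -natrM mulnb andbb.
Qed.

Lemma match_on_depends Q x : depends_on [set pos x s | s in Q]%SET (match_on Q x).
Proof.
by move=> w w' h; apply: eq_bigr => s Qs; rewrite h//; exact: imset_f.
Qed.

Lemma match_ind_depends x : depends_on (support x) (match_ind x).
Proof. by move=> w w' h; apply: eq_bigr => s Qs; rewrite h//; exact: imset_f. Qed.

(** Grouping the factors by point gives a product over all of [I], ready for [ex_prod]. Injectivity
    of [pos x] leaves at most one factor per point, and points without a factor contribute the total
    mass 1. *)
Lemma ex_match_on Q x : E (match_on Q x) = \prod_(s | Q s) p (col s).
Proof.
pose F i b : R := \prod_(s | Q s && (pos x s == i)) (b == col s)%:R.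
rewrite (@eq_ex _ _ _ _ _ (fun w => \prod_i F i (w i))); last first.
  move=> w; rewrite /match_on (partition_big (pos x) predT)//=.
  by apply: eq_bigr => i _; apply: eq_bigr => s /andP[_ /eqP ->].
rewrite ex_prod [RHS](partition_big (pos x) predT)//=; apply: eq_bigr => i _.
rewrite /F; have [s /andP[Qs /eqP si]|noS] := pickP (fun s => Q s && (pos x s == i)).
  have sE t : Q t && (pos x t == i) = (t == s).
    apply/andP/eqP => [[_ /eqP ti]|->]; last by rewrite Qs si.
    by apply: (@pos_inj x); rewrite ti.
  under eq_bigr do rewrite (eq_bigl _ _ sE) big_pred1_eq.
  rewrite (eq_bigl _ _ sE) big_pred1_eq (bigD1 (col s))//= eqxx mulr1.
  by rewrite big1 ?addr0// => b /negPf ->; rewrite mulr0.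
rewrite [RHS]big_pred0//; under eq_bigr do rewrite big_pred0// mulr1.
exact: p_sum1.
Qed.

Lemma ex_match_ind x : E (match_ind x) = match_prob.
Proof. exact: ex_match_on. Qed.

Lemma match_prob_ge0 : 0 <= match_prob.
Proof. by apply: prodr_ge0. Qed.

Lemma match_prob_but_ge0 s : 0 <= match_prob_but s.
Proof. by apply: prodr_ge0. Qed.

Lemma match_probE s : match_prob = p (col s) * match_prob_but s.
Proof. by rewrite /match_prob (bigD1 s). Qed.

Lemma match_prob_le_but s : match_prob <= match_prob_but s.
Proof. by rewrite (match_probE s) ler_piMl// match_prob_but_ge0. Qed.

Lemma match_prob_le1 : match_prob <= 1.
Proof. by apply: prodr_ile1 => s _; rewrite p_ge0 p_le1. Qed.

(** An occurrence is determined by its points at two positions: once the one at [s] is restricted to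
    [S], only the choice at [t] is free. *)
Lemma card_pos_in S s t : s != t -> (#|[set x | pos x s \in S]%SET| <= #|S| * n)%N.
Proof.
move=> st; rewrite -(card_imset _ (pos_two st)).
rewrite -[n]cardsT -cardsX; apply: subset_leq_card; apply/fintype.subsetP => u.
by case/imsetP => x; rewrite inE => xS ->; rewrite !inE /= xS.
Qed.

Lemma card_pos_in2 S s t : s != t ->
  (#|[set x | (pos x s \in S) && (pos x t \in S)]%SET| <= #|S| * #|S|)%N.
Proof.
move=> st; rewrite -(card_imset _ (pos_two st)).
rewrite -cardsX; apply: subset_leq_card; apply/fintype.subsetP => u.
by case/imsetP => x; rewrite inE => /andP[xS tS] ->; rewrite !inE /= xS.
Qed.

Section ConditionalBound.
Variables (S : {set I}) (g : Omega -> R).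
Hypotheses (g_ge0 : forall w, 0 <= g w) (g_dep : depends_on S g).

Definition touch x s : R := (pos x s \in S)%:R.

(* If [pos x s] is the only point of [x] in [S], then the remaining points are
   independent of [g]; if there is a second one, the indicator is bounded by 1. *)
Lemma ex_match_cond x : ~~ [disjoint S & support x]%B ->
  E (fun w => g w * (match_ind x w + match_prob)) <=
  E g * (\sum_s (touch x s * (2 * match_prob_but s)
      + \sum_(t | t != s) 2 * (touch x s * touch x t))).
Proof.
move=> Sx.
have Eg0 : 0 <= E g by apply: ex_ge0.
have touch0 t : 0 <= touch x t by rewrite ler0n.
have [s sS] : exists s, pos x s \in S.
  have [i] := pred0Pn Sx => /andP[/= iS /imsetP[s _ si]].
  by exists s; rewrite -si.
have rest0 s' : 0 <= touch x s' * (2 * match_prob_but s')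
      + \sum_(t | t != s') 2 * (touch x s' * touch x t).
  rewrite addr_ge0 ?mulr_ge0 ?match_prob_but_ge0//.
  by apply: sumr_ge0 => t _; rewrite !mulr_ge0.
have -> : E (fun w => g w * (match_ind x w + match_prob)) =
    E (fun w => g w * match_ind x w) + E g * match_prob.
  by rewrite -[E g * _]mulrC -exZ -exD; apply: eq_ex => w; ring.
apply: (@le_trans _ _ (E g * (touch x s * (2 * match_prob_but s)
      + \sum_(t | t != s) 2 * (touch x s * touch x t)))); last first.
  rewrite ler_wpM2l// [leRHS](bigD1 s)//= lerDl.
  by apply: sumr_ge0.
have sS1 : touch x s = 1 by rewrite /touch sS.
rewrite sS1 mul1r.
have Mle := ler_wpM2l Eg0 (match_prob_le_but s).
(* The factors 2 in the bound make room for the summand [match_prob], which is at most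
   [match_prob_but s] and at most 1. *)
have [/existsP[t /andP[ts tS]]|none] := boolP [exists t, (t != s) && (pos x t \in S)].
  have Ele : E (fun w => g w * match_ind x w) <= E g.
    apply: le_ex => // w; rewrite ler_piMr//; exact: match_on_le1.
  have two : 2 <= \sum_(t | t != s) 2 * (1 * touch x t).
    rewrite (bigD1 t)//= /touch tS mul1r mulr1 lerDl.
    by apply: sumr_ge0 => k _; rewrite mul1r mulr_ge0.
  have m1 := ler_wpM2l Eg0 match_prob_le1.
  have m0 := mulr_ge0 Eg0 (match_prob_but_ge0 s).
  have := ler_wpM2l Eg0 two; rewrite mulrDr; lra.
have rest : 0 <= \sum_(t | t != s) 2 * (1 * touch x t).
  by apply: sumr_ge0 => k _; rewrite mul1r mulr_ge0.
have : E (fun w => g w * match_ind x w) <= E g * match_prob_but s.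
  apply: (@le_trans _ _ (E (fun w => g w * match_on (fun t => t != s) x w))).
    by apply: le_ex => // w; rewrite ler_wpM2l// match_ind_le.
  rewrite (ex_indep p_sum1 _ g_dep (@match_on_depends _ x)); last first.
    rewrite disjoint_subset; apply/fintype.subsetP => i iS; rewrite inE.
    apply/imsetP => -[t ts it]; move/existsP: none; apply.
    by exists t; rewrite -it iS andbT.
  by rewrite ex_match_on.
have := mulr_ge0 Eg0 rest; rewrite mulrDr; lra.
Qed.

End ConditionalBound.

Variable M : R.
Hypotheses (M_ge1 : 1 <= M) (M_but : forall s, n%:R * match_prob_but s <= M).
Hypothesis r_ge2 : (2 <= r)%N.

(** Each of the [r] positions [s] contributes [4 r] through occurrences with [pos x s] in [S], at
    most [2 r n] in number and weighted by [2 * match_prob_but s], and [8 r^3] through a second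
    point in [S]: [r] positions, [(2 r)^2] occurrences, weight 2. *)
Definition moment_factor : R := (4 * r ^ 2 + 8 * r ^ 4)%N%:R.

Let other s : exists t, s != t.
Proof.
have r0 : (0 < r)%N by exact: leq_trans r_ge2.
have [->|s0] := eqVneq s (Ordinal r0); last by exists (Ordinal r0).
by exists (Ordinal r_ge2).
Qed.

(** Summing out one neighbor costs the factor [moment_factor * M]. The size [2 * r] allows [S] to be
    the union of two supports, so the estimate can be iterated up to the third occurrence. *)
Lemma sum_ex_match_cond S (g : Omega -> R) : (#|S| <= 2 * r)%N ->
  (forall w, 0 <= g w) -> depends_on S g ->
  \sum_(x | ~~ [disjoint S & support x]%B)
    E (fun w => g w * (match_ind x w + match_prob)) <=
  moment_factor * M * E g.
Proof.
move=> S2r g0 gS.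
have Eg0 : 0 <= E g by apply: ex_ge0.
apply: (@le_trans _ _ (\sum_x E g * (\sum_s (touch S x s * (2 * match_prob_but s)
      + \sum_(t | t != s) 2 * (touch S x s * touch S x t))))).
  rewrite [leRHS](bigID (fun x => ~~ [disjoint S & support x]%B))/=.
  rewrite ler_wpDr//.
    apply: sumr_ge0 => x _; rewrite mulr_ge0//; apply: sumr_ge0 => s _.
    rewrite addr_ge0 ?mulr_ge0 ?match_prob_but_ge0 ?ler0n//.
    by apply: sumr_ge0 => t _; rewrite !mulr_ge0 ?ler0n.
  by apply: ler_sum => x Sx; exact: ex_match_cond.
rewrite -mulr_sumr [leRHS]mulrC ler_wpM2l// exchange_big/=.
apply: (@le_trans _ _ (\sum_(s < r) (4 * r + 8 * r ^ 3)%N%:R * M)); last first.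
  rewrite sumr_const card_ord -[leLHS]mulr_natl mulrA -natrM ler_wpM2r ?(le_trans ler01)//.
  by rewrite ler_nat mulnDr; apply: eq_leq; ring.
apply: ler_sum => s _; rewrite big_split/= -mulr_suml.
have cardS : #|S|%:R <= (2 * r)%N%:R :> R by rewrite ler_nat.
have [t st] := other s.
have h1 : \sum_x touch S x s <= (2 * r)%N%:R * n%:R.
  rewrite -natr_sum (eq_bigr (fun x => if pos x s \in S then 1%N else 0%N)); last first.
    by move=> x _; case: (_ \in _).
  rewrite -big_mkcond sum1dep_card -natrM ler_nat.
  apply: leq_trans (card_pos_in S st) _; exact: leq_mul.
have h2 : \sum_x \sum_(t | t != s) 2 * (touch S x s * touch S x t) <= (8 * r ^ 3)%N%:R.
  rewrite exchange_big/=.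
  apply: (@le_trans _ _ (\sum_(t < r) (8 * r ^ 2)%N%:R)); last first.
    by rewrite sumr_const card_ord -[leLHS]mulr_natr -natrM ler_nat; apply: eq_leq; ring.
  rewrite [leRHS](bigID (fun t => t != s))/= ler_wpDr ?sumr_ge0//.
  apply: ler_sum => k ks; rewrite -mulr_sumr.
  under eq_bigr do rewrite /touch -natrM mulnb.
  rewrite -natr_sum (eq_bigr (fun x =>
    if (pos x s \in S) && (pos x k \in S) then 1%N else 0%N)); last first.
    by move=> x _; case: (_ && _).
  rewrite -big_mkcond sum1dep_card -natrM ler_nat.
  have sk : s != k by rewrite eq_sym.
  apply: leq_trans (leq_mul (leqnn 2) (card_pos_in2 S sk)) _.
  apply: leq_trans (leq_mul (leqnn 2) (leq_mul S2r S2r)) _.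
  by apply: eq_leq; ring.
have but0 := match_prob_but_ge0 s.
have h3 := ler_wpM2r (mulr_ge0 (ler0n R 2) but0) h1.
have h4 : (2 * r)%N%:R * n%:R * (2 * match_prob_but s) <= (4 * r)%N%:R * M.
  rewrite [leLHS](_ : _ = (4 * r)%N%:R * (n%:R * match_prob_but s)).
    by rewrite ler_wpM2l.
  by rewrite !natrM; ring.
have h5 : (8 * r ^ 3)%N%:R <= (8 * r ^ 3)%N%:R * M by rewrite ler_peMr.
by rewrite natrD mulrDl; lra.
Qed.

Local Notation meet := (meets support).

(** [match_ind x w + match_prob] majorizes the centered indicator in absolute value; being
    nonnegative and determined by the same points, it can itself serve as the [g] of the next
    step. *)
Let near_ge0 x w : 0 <= match_ind x w + match_prob.
Proof. by rewrite addr_ge0 ?match_prob_ge0// match_on_ge0. Qed.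

Let near_dep x : depends_on (support x) (fun w => match_ind x w + match_prob).
Proof.
by apply: (@depends_on_comp _ _ _ _ _ (fun u => u + match_prob)); exact: match_ind_depends.
Qed.

Let near2_dep x y : depends_on (support x :|: support y)%SET
  (fun w => (match_ind x w + match_prob) * (match_ind y w + match_prob)).
Proof.
by apply: depends_onM; [apply: (depends_onS _ (@near_dep x)); exact: finset.subsetUl|
                        apply: (depends_onS _ (@near_dep y)); exact: finset.subsetUr].
Qed.

Let card_support2 x y : (#|support x :|: support y|%SET <= 2 * r)%N.
Proof.
rewrite mul2n -addnn; apply: leq_trans (leq_card_setU _ _) _.
by apply: leq_add; exact: card_support.
Qed.

Let meetU x y z : (~~ [disjoint support x :|: support y & support z]%SET%B) =
  meet x z || meet y z.
Proof.
by rewrite /meets -!setI_eq0 finset.setIUl finset.setU_eq0 negb_and.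
Qed.

Let E_near x : E (fun w => match_ind x w + match_prob) = 2 * match_prob.
Proof. by rewrite exD ex_match_ind ex_cst// mulr2n mulrDl mul1r. Qed.

Lemma sum_near2 x :
  \sum_(y | meet x y)
    E (fun w => (match_ind x w + match_prob) * (match_ind y w + match_prob))
  <= moment_factor * M * (2 * match_prob).
Proof.
rewrite -(E_near x).
apply: sum_ex_match_cond => //.
by apply: leq_trans (card_support x) _; rewrite mul2n -addnn leq_addr.
Qed.

Lemma sum_near3 :
  \sum_x \sum_(y | meet x y) \sum_(z | meet x z || meet y z)
    E (fun w => (match_ind x w + match_prob) * (match_ind y w + match_prob) *
      (match_ind z w + match_prob))
  <= N%:R * ((moment_factor * M) ^+ 2 * (2 * match_prob)).
Proof.
rewrite mulr_natl -sumr_const; apply: ler_sum => x _.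
rewrite expr2 -mulrA; apply: le_trans (ler_wpM2l _ (sum_near2 x)); last first.
  by rewrite mulr_ge0 ?ler0n ?(le_trans ler01)//.
rewrite mulr_sumr; apply: ler_sum => y _.
under eq_bigl do rewrite -meetU.
by apply: sum_ex_match_cond => // w; rewrite mulr_ge0.
Qed.

Lemma sum_near3' :
  \sum_x \sum_(y | meet x y) \sum_(z | meet x z || meet y z)
    E (fun w => (match_ind x w + match_prob) * (match_ind y w + match_prob)) *
    E (fun w => match_ind z w + match_prob)
  <= N%:R * ((moment_factor * M) ^+ 2 * (2 * match_prob)).
Proof.
rewrite mulr_natl -sumr_const; apply: ler_sum => x _.
rewrite expr2 -mulrA; apply: le_trans (ler_wpM2l _ (sum_near2 x)); last first.
  by rewrite mulr_ge0 ?ler0n ?(le_trans ler01)//.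
rewrite mulr_sumr; apply: ler_sum => y _.
under eq_bigl do rewrite -meetU.
rewrite -mulr_sumr mulrC ler_wpM2r//.
  by apply: ex_ge0 => // w; rewrite mulr_ge0.
(* Taking the constant 1 for [g] covers the case where the third factor has been averaged
   separately. *)
have := @sum_ex_match_cond (support x :|: support y)%SET (fun=> 1) (card_support2 x y)
  (fun=> ler01) (fun _ _ _ => erefl).
rewrite ex_cst// mulr1; apply: le_trans; apply: ler_sum => z _.
by apply: le_ex => // w; rewrite mul1r.
Qed.

Definition match_count w := \sum_x match_ind x w.

Definition match_var := E (fun w => (match_count w - N%:R * match_prob) ^+ 2).

Let r_gt0 : (0 < r)%N. Proof. exact: leq_trans r_ge2. Qed.

Let meet_refl x : meet x x.
Proof.
apply/pred0Pn; exists (pos x (Ordinal r_gt0)).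
by rewrite /= !support_mem.
Qed.

Lemma card_meet x : (#|[pred y | meet x y]| <= r * (r * n))%N.
Proof.
rewrite -sum1_card.
apply: (@leq_trans (\sum_(s < r) \sum_(y | pos y s \in support x) 1)).
  rewrite (exchange_big_dep predT)//= [leqRHS](bigID (meet x))/=.
  apply: leq_trans (leq_addr _ _); apply: leq_sum => y /pred0Pn[i /andP[/= iS]].
  move=> /imsetP[s _ si]; rewrite sum1_card; apply/card_gt0P.
  by exists s; rewrite unfold_in -si.
have -> : (r * (r * n) = \sum_(s < r) (r * n))%N by rewrite sum_nat_const card_ord.
apply: leq_sum => s _; rewrite sum1dep_card.
have [t st] := other s.
apply: leq_trans (card_pos_in (support x) st) _.
by rewrite leq_mul2r card_support orbT.
Qed.

Let sum_center w : match_count w - N%:R * match_prob = \sum_x (match_ind x w - match_prob).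
Proof. by rewrite sumrB sumr_const mulr_natl. Qed.

Let center_dep x : depends_on (support x) (fun w => match_ind x w - match_prob).
Proof.
by apply: (@depends_on_comp _ _ _ _ _ (fun u => u - match_prob)); exact: match_ind_depends.
Qed.

Let center_mean x : E (fun w => match_ind x w - match_prob) = 0.
Proof. by rewrite exB ex_match_ind ex_cst// subrr. Qed.

Let ex_center2 x y :
  E (fun w => (match_ind x w - match_prob) * (match_ind y w - match_prob)) =
  E (fun w => match_ind x w * match_ind y w) - match_prob ^+ 2.
Proof.
transitivity (E (fun w => (match_ind x w * match_ind y w - match_prob * match_ind x w)
   - match_prob * (match_ind y w - match_prob))).
  by apply: eq_ex => w; ring.
rewrite !exB !exZ !exB !ex_match_ind ex_cst//; ring.
Qed.

(** Non-meeting pairs have covariance zero, and a meeting pair has covariance at least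
    [- match_prob ^+ 2], the mean of a product of indicators being nonnegative. Each occurrence
    meets at most [r^2 n] others, itself included. *)
Lemma match_var_ge_diag :
  N%:R * match_prob * (1 - (r ^ 2)%N%:R * (n%:R * match_prob)) <= match_var.
Proof.
rewrite /match_var (@eq_ex _ _ _ _ _ (fun w => \sum_x \sum_y
  (match_ind x w - match_prob) * (match_ind y w - match_prob))); last first.
  by move=> w; rewrite sum_center expr2 big_distrlr.
rewrite ex_sum -mulrA mulr_natl -sumr_const; apply: ler_sum => x _.
rewrite ex_sum (bigID (meet x))/= [X in _ <= _ + X]big1 ?addr0; last first.
  move=> y; rewrite negbK => xy.
  by rewrite (ex_indep p_sum1 xy (@center_dep x) (@center_dep y)) center_mean mul0r.
under eq_bigr do rewrite ex_center2.
rewrite sumrB sumr_const.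
have h1 : match_prob <= \sum_(y | meet x y) E (fun w => match_ind x w * match_ind y w).
  rewrite (bigD1 x)//= (eq_ex _ (match_ind_sqr x)) ex_match_ind lerDl.
  by apply: sumr_ge0 => y _; apply: ex_ge0 => // w; rewrite mulr_ge0// match_on_ge0.
have h2 : match_prob ^+ 2 *+ #|[pred y | meet x y]| <=
    match_prob ^+ 2 * ((r ^ 2)%N%:R * n%:R).
  rewrite -[leLHS]mulr_natr ler_wpM2l ?sqr_ge0// -natrM ler_nat.
  by rewrite -mulnn -mulnA card_meet.
apply: le_trans (lerB h1 h2).
by rewrite le_eqVlt; apply/orP; left; apply/eqP; ring.
Qed.

Section LinearStatistic.
Variable s : 'I_r.
Let q := p (col s).
Let hit v w : R := (w v == col s)%:R.
Let L w := \sum_v (hit v w - q).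

Let hit_dep v : depends_on [set v]%SET (hit v).
Proof. by move=> w w' h; rewrite /hit h// inE. Qed.

Let hitq_dep v : depends_on [set v]%SET (fun w => hit v w - q).
Proof. by apply: (@depends_on_comp _ _ _ _ _ (fun u => u - q)). Qed.

Let ex_hit v : E (hit v) = q.
Proof.
pose F i b : R := if i == v then (b == col s)%:R else 1.
rewrite (@eq_ex _ _ _ _ _ (fun w => \prod_i F i (w i))); last first.
  move=> w; rewrite /F (bigD1 v)//= eqxx [X in _ = _ * X]big1 ?mulr1//.
  by move=> i /negPf iv; rewrite iv.
rewrite ex_prod (bigD1 v)//= /F eqxx [X in _ * X = _]big1 ?mulr1; last first.
  move=> i /negPf iv; rewrite iv -[RHS]p_sum1.
  by apply: eq_bigr => b _; rewrite mulr1.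
rewrite (bigD1 (col s))//= eqxx mulr1 big1 ?addr0// => b bs.
by rewrite (negPf bs) mulr0.
Qed.

Let ex_hitq v : E (fun w => hit v w - q) = 0.
Proof. by rewrite exB ex_hit ex_cst// subrr. Qed.

Let ex_L2 : E (fun w => L w ^+ 2) <= n%:R * q.
Proof.
rewrite (@eq_ex _ _ _ _ _ (fun w => \sum_v \sum_u (hit v w - q) * (hit u w - q))); last first.
  by move=> w; rewrite expr2 big_distrlr.
rewrite ex_sum mulr_natl -sumr_const; apply: ler_sum => v _.
rewrite ex_sum (bigD1 v)//= [X in _ + X <= _]big1 ?addr0; last first.
  move=> u uv; rewrite (ex_indep p_sum1 _ (hitq_dep (v:=v)) (hitq_dep (v:=u))) ?ex_hitq ?mul0r//.
  by rewrite disjoints1 inE eq_sym.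
rewrite (@eq_ex _ _ _ _ _ (fun w => hit v w - (q * (hit v w + (hit v w - q))))); last first.
  move=> w; have : hit v w * hit v w = hit v w by rewrite /hit -natrM mulnb andbb.
  by move=> e; transitivity (hit v w * hit v w - q * (hit v w + (hit v w - q)));
    [ring|rewrite e].
rewrite exB exZ exD ex_hitq ex_hit addr0 lerBlDr lerDl.
by apply: mulr_ge0; exact: p_ge0.
Qed.

Let ex_match_hit x v : v \notin support x ->
  E (fun w => match_ind x w * (hit v w - q)) = 0.
Proof.
move=> vx; rewrite (ex_indep p_sum1 _ (@match_ind_depends x) (hitq_dep (v:=v))).
  by rewrite ex_hitq mulr0.
by rewrite fintype.disjoint_sym disjoints1.
Qed.

(** Points outside the support are independent of the match and average to zero. The point at
    position [s] surely has the color [col s] on a match, which yields [match_prob]; centering costs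
    at most [match_prob * q] for each of the at most [r] points. *)
Let ex_match_L x : match_prob * (1 - r%:R * q) <= E (fun w => match_ind x w * L w).
Proof.
rewrite (@eq_ex _ _ _ _ _ (fun w => \sum_v match_ind x w * (hit v w - q))); last first.
  by move=> w; rewrite mulr_sumr.
rewrite ex_sum (bigID (mem (support x)))/= [X in _ <= _ + X]big1 ?addr0; last first.
  by move=> v; exact: ex_match_hit.
have hE v : E (fun w => match_ind x w * (hit v w - q)) =
    E (fun w => match_ind x w * hit v w) - match_prob * q.
  rewrite -(ex_match_ind x) mulrC -exZ -exB; apply: eq_ex => w; ring.
under eq_bigr do rewrite hE.
rewrite sumrB sumr_const (bigD1 (pos x s)) ?support_mem//=.
have -> : E (fun w => match_ind x w * hit (pos x s) w) = match_prob.
  rewrite -(ex_match_ind x); apply: eq_ex => w.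
  rewrite /match_ind /match_on (bigD1 s)//= /hit.
  by case: (_ == _); rewrite ?mulr1 ?mulr0 ?mul0r.
have h1 : 0 <= \sum_(i in support x | i != pos x s) E (fun w => match_ind x w * hit i w).
  by apply: sumr_ge0 => v _; apply: ex_ge0 => // w; rewrite mulr_ge0 ?match_on_ge0// ler0n.
have q0 : 0 <= q := p_ge0 _.
have h2 : match_prob * q *+ #|support x| <= match_prob * (r%:R * q).
  rewrite -[leLHS]mulr_natl mulrCA ler_wpM2l ?match_prob_ge0//.
  by rewrite ler_wpM2r// ler_nat card_support.
rewrite mulrBr mulr1; lra.
Qed.

(* Cauchy-Schwarz against the number of points of color [col s]. *)
Lemma match_var_ge_linear : 0 < n%:R * q -> r%:R * q <= 1 / 2 ->
  (N%:R * match_prob / 2) ^+ 2 / (n%:R * q) <= match_var.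
Proof.
move=> nq0 rq.
(* [c] is a lower bound for the covariance of the count with [L], the half coming from [r q <= 1/2].
   The value [t] maximizes the resulting lower bound [2 t c - t^2 n q] for the variance. *)
set c := N%:R * match_prob / 2; set t := c / (n%:R * q).
have c0 : 0 <= c by rewrite /c !mulr_ge0 ?match_prob_ge0// invr_ge0.
have t0 : 0 <= t by rewrite divr_ge0// ltW.
have EL : E L = 0.
  by rewrite /L ex_sum big1// => v _; exact: ex_hitq.
have EXL : c <= E (fun w => (match_count w - N%:R * match_prob) * L w).
  rewrite (@eq_ex _ _ _ _ _ (fun w => \sum_x match_ind x w * L w -
    (N%:R * match_prob) * L w)); last by move=> w; rewrite mulrBl /match_count mulr_suml.
  rewrite exB exZ EL mulr0 subr0 ex_sum /c -mulrA mulr_natl -sumr_const.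
  apply: ler_sum => x _; apply: le_trans (ex_match_L x).
  by rewrite ler_wpM2l ?match_prob_ge0//; lra.
have : 0 <= E (fun w => ((match_count w - N%:R * match_prob) - t * L w) ^+ 2).
  by apply: ex_ge0 => // w; exact: sqr_ge0.
rewrite (@eq_ex _ _ _ _ _ (fun w => (match_count w - N%:R * match_prob) ^+ 2 -
  ((2 * t) * ((match_count w - N%:R * match_prob) * L w) - t ^+ 2 * L w ^+ 2))); last first.
  by move=> w; ring.
rewrite exB exB !exZ -/match_var.
have h1 := ler_wpM2l (sqr_ge0 t) ex_L2.
have h2 : 2 * t * c <= 2 * t * E (fun w => (match_count w - N%:R * match_prob) * L w).
  by rewrite ler_wpM2l// mulr_ge0.
have -> : c ^+ 2 / (n%:R * q) = t * c by rewrite /t; ring.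
have : t ^+ 2 * (n%:R * q) = t * c.
  rewrite expr2 -mulrA /t divfK ?gt_eqF//.
lra.
Qed.

End LinearStatistic.

Let sd := Num.sqrt match_var.

Definition standardized_count w : R := (match_count w - N%:R * match_prob) / sd.

Lemma stein_bound_match_count (h : R -> R) : 0 < match_var ->
  (forall u v : R, `|h v - h u| <= `|v - u|) ->
  `|E (fun w => h (standardized_count w)) - gaussian_mean h| <=
  stein_constant R * (4 * moment_factor ^+ 2 * M ^+ 2 * (N%:R * match_prob) / sd ^+ 3).
Proof.
move=> V0 h1; have sd0 : 0 < sd by rewrite sqrtr_gt0.
pose Y x w := (match_ind x w - match_prob) / sd.
have WE w : standardized_count w = \sum_x Y x w.
  by rewrite /standardized_count sum_center mulr_suml.
apply: (@stein_method R _ (@prod_weight R I C p) standardized_count) => //.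
- exact: prod_weight_ge0.
- exact: prod_weight_sum1.
move=> f df fdf dfL.
have Y_dep x : depends_on (support x) (Y x).
  by apply: (@depends_on_comp _ _ _ _ _ (fun u => (u - match_prob) / sd));
    exact: match_ind_depends.
have Y_mean x : E (Y x) = 0.
  rewrite (@eq_ex _ _ _ _ _ (fun w => sd^-1 * (match_ind x w - match_prob))).
    by rewrite exZ center_mean mulr0.
  by move=> w; rewrite mulrC.
have W_var : E (fun w => (\sum_x Y x w) ^+ 2) = 1.
  rewrite (@eq_ex _ _ _ _ _ (fun w => match_var^-1 *
    (match_count w - N%:R * match_prob) ^+ 2)); last first.
    move=> w; rewrite -WE /standardized_count expr_div_n sqr_sqrtr ?ltW//.
    by rewrite mulrC.
  by rewrite exZ mulVf// gt_eqF.
have := local_dependence_bound p_ge0 p_sum1 Y_dep Y_mean W_var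
  (stein_constant_ge0 R) (taylor1_lipschitz fdf dfL) dfL.
rewrite -(@eq_ex _ _ _ p (fun w => df (standardized_count w) -
  standardized_count w * f (standardized_count w))); last by move=> w; rewrite /= WE.
move=> bound; apply: le_trans bound _; rewrite ler_wpM2l ?stein_constant_ge0//=.
have Yle x w : `|Y x w| <= sd^-1 * (match_ind x w + match_prob).
  rewrite /Y normrM normfV (gtr0_norm sd0) mulrC ler_pM2l ?invr_gt0//.
  apply: le_trans (ler_normB _ _) _.
  by rewrite !ger0_norm ?match_prob_ge0// match_on_ge0.
have Y2 x y w : `|Y x w * Y y w| <= sd^-1 ^+ 2 *
    ((match_ind x w + match_prob) * (match_ind y w + match_prob)).
  rewrite normrM; apply: le_trans (ler_pM _ _ (Yle x w) (Yle y w)) _ => //.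
  by rewrite le_eqVlt; apply/orP; left; apply/eqP; ring.
have s0 : 0 <= sd^-1 by rewrite invr_ge0 ltW.
(* The two triple sums share one bound; their number and the 2 in [2 * match_prob] make up the
   constant 4. *)
apply: (@le_trans _ _ (sd^-1 ^+ 3 * (N%:R * ((moment_factor * M) ^+ 2 * (2 * match_prob)) +
   N%:R * ((moment_factor * M) ^+ 2 * (2 * match_prob))))); last first.
  by rewrite -exprVn le_eqVlt; apply/orP; left; apply/eqP; ring.
apply: le_trans (ler_wpM2l _ (lerD sum_near3 sum_near3')); last exact: exprn_ge0.
rewrite -big_split/= mulr_sumr; apply: ler_sum => x _.
rewrite -big_split/= mulr_sumr; apply: ler_sum => y _.
rewrite -big_split/= mulr_sumr; apply: ler_sum => z _.
rewrite mulrDr; apply: lerD.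
  rewrite -exZ; apply: le_ex => // w; rewrite normrM.
  apply: le_trans (ler_pM _ _ (Y2 x y w) (Yle z w)) _ => //.
  by rewrite le_eqVlt; apply/orP; left; apply/eqP; ring.
have -> : sd^-1 ^+ 3 * (E (fun w => (match_ind x w + match_prob) * (match_ind y w + match_prob)) *
    E (fun w => match_ind z w + match_prob)) =
  E (fun w => sd^-1 ^+ 2 * ((match_ind x w + match_prob) * (match_ind y w + match_prob))) *
    E (fun w => sd^-1 * (match_ind z w + match_prob)) by rewrite !exZ; ring.
apply: ler_pM.
- by apply: ex_ge0 => // w; exact: normr_ge0.
- by apply: ex_ge0 => // w; exact: normr_ge0.
- by apply: le_ex => // w; exact: Y2.
- by apply: le_ex => // w; exact: Yle.
Qed.

End PatternCount.

(** The standard deviation is bounded below up to the factor [4 r], which enters cubed; [2 r] comes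
    from replacing the number of occurrences by [n^2 / (4 r^2)] under a square root. *)
Definition pattern_constant (R : realType) (r : nat) : R :=
  stein_constant R * (4 * moment_factor R r ^+ 2 * (4 * r%:R) ^+ 3 * (2 * r%:R)).

(* Applied with [u ^+ 2] the mean of the count and [m ^+ 2] the factor [M] of
   [stein_bound_match_count]. *)
Lemma moment_ratio_le (R : realType) (u m k sd : R) :
  0 < u -> 0 < m -> 0 < k -> u * m <= k * sd ->
  (m ^+ 2) ^+ 2 * u ^+ 2 / sd ^+ 3 <= k ^+ 3 * (m / u).
Proof.
move=> u0 m0 k0 h; have sd0 : 0 < sd.
  by rewrite -(pmulr_rgt0 _ k0); apply: lt_le_trans h; rewrite mulr_gt0.
rewrite ler_pdivrMr ?exprn_gt0//.
apply: (@le_trans _ _ (m / u * (u * m) ^+ 3)).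
  by rewrite le_eqVlt; apply/orP; left; apply/eqP; field; rewrite gt_eqF.
rewrite [leRHS](_ : _ = m / u * (k * sd) ^+ 3); last by ring.
apply: ler_wpM2l; first by rewrite divr_ge0// ltW.
by apply: lerXn2r => //; rewrite nnegrE mulr_ge0// ltW.
Qed.

Lemma pattern_normal_approximation (R : realType) (I C A : finType) (r : nat)
    (p : C -> R) (pos : A -> 'I_r -> I) (col : 'I_r -> C) (s : 'I_r) :
  (forall b, 0 <= p b) -> \sum_b p b = 1 ->
  (forall x, injective (pos x)) ->
  (forall s t, s != t -> injective (fun x => (pos x s, pos x t))) ->
  (2 <= r)%N -> (0 < #|I|)%N -> (#|I| ^ 2 <= 4 * r ^ 2 * #|A|)%N ->
  (forall t, p (col s) <= p (col t)) -> 0 < p (col s) ->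
  p (col s) * (2 * r%:R ^+ 2) <= 1 ->
  forall h : R -> R, (forall u v, `|h v - h u| <= `|v - u|) ->
  `|ex p (fun w => h (standardized_count p pos col w)) - gaussian_mean h| <=
  pattern_constant R r *
  Num.max (Num.sqrt (#|I|%:R ^+ 2 * match_prob p col)^-1)
          (Num.sqrt (#|I|%:R * p (col s))^-1).
Proof.
move=> p0 p1 pinj ptwo r2 I0 IA smin b0 br h h1.
set n : R := #|I|%:R; set N : R := #|A|%:R; set b := p (col s) in smin b0 br *.
set q := match_prob p col; set qs := match_prob_but p col s.
have n0 : 0 < n by rewrite ltr0n.
have IA' : n ^+ 2 <= 4 * r%:R ^+ 2 * N.
  by rewrite /n /N -!natrX -!natrM ler_nat.
have r0 : 0 < r%:R :> R by rewrite ltr0n; exact: leq_trans r2.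
have rr : 1 <= r%:R ^+ 2 :> R by rewrite -natrX ler1n expn_gt0 (leq_trans _ r2).
have N0 : 0 < N.
  have := exprn_gt0 2 n0; rewrite -(pmulr_rgt0 N (_ : 0 < 4 * r%:R ^+ 2 :> R)).
    by move=> h2; exact: lt_le_trans IA'.
  by rewrite mulr_gt0// exprn_gt0.
have qE : q = b * qs := match_probE p col s.
have qs0 : 0 < qs.
  by rewrite /qs /match_prob_but; apply: prodr_gt0 => t _; exact: lt_le_trans (smin t).
have q0 : 0 < q by rewrite qE mulr_gt0.
set M := Num.max 1 (n * qs).
have M1 : 1 <= M by rewrite le_max lexx.
have M0 : 0 < M by exact: lt_le_trans M1.
(* Removing the rarest color leaves the largest product, so [qs] dominates every
   [match_prob_but]. *)
have Mt t : n * match_prob_but p col t <= M.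
  rewrite le_max; apply/orP; right; rewrite ler_wpM2l ?(ltW n0)//.
  have := match_probE p col t; rewrite -/q => qEt.
  rewrite -(ler_pM2l b0) -qE qEt ler_wpM2r//.
  exact: match_prob_but_ge0.
(* Up to [n qs = 1] the diagonal bound applies, with [r^2 n q <= r^2 b <= 1/2]; beyond it the linear
   bound does. There the 4 from squaring the half in [c] and [n^2 <= 4 r^2 N] combine to
   [16 r^2]. *)
have V_ge : N * q * M / (16 * r%:R ^+ 2) <= match_var p pos col.
  have [nqs|nqs] := leP (n * qs) 1.
    have -> : M = 1 by rewrite /M max_l.
    apply: le_trans (match_var_ge_diag col p0 p1 pinj ptwo r2).
    rewrite -/n -/N -/q natrX mulr1 ler_wpM2l ?mulr_ge0 ?(ltW N0) ?(ltW q0)//.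
    have : r%:R ^+ 2 * (n * q) <= 2^-1.
      rewrite qE; apply: (@le_trans _ _ (r%:R ^+ 2 * b)).
        by rewrite ler_wpM2l ?sqr_ge0// mulrCA ler_piMr// ltW.
      by rewrite mulrC; lra.
    have : (16 * r%:R ^+ 2)^-1 <= 2^-1 :> R by rewrite lef_pV2 ?posrE//; lra.
    lra.
  have -> : M = n * qs by rewrite /M max_r// ltW.
  have nb : 0 < n * b by rewrite mulr_gt0.
  have rb : r%:R * b <= 1 / 2.
    have : r%:R * b <= r%:R ^+ 2 * b.
      by rewrite ler_wpM2r ?(ltW b0)// -natrX ler_nat -mulnn leq_pmulr// (leq_trans _ r2).
    lra.
  apply: le_trans (match_var_ge_linear p0 p1 pinj nb rb).
  rewrite -/n -/N -/q -/b ler_pdivlMr//.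
  rewrite [leLHS](_ : _ = N * q ^+ 2 * (n ^+ 2 / (16 * r%:R ^+ 2))); last first.
    by rewrite qE; field; rewrite gt_eqF.
  rewrite [leRHS](_ : _ = N * q ^+ 2 * (N / 4)); last by field.
  apply: ler_wpM2l; first by rewrite mulr_ge0 ?sqr_ge0// ltW.
  by rewrite ler_pdivrMr ?mulr_gt0 ?exprn_gt0//; lra.
have V0 : 0 < match_var p pos col.
  by apply: lt_le_trans V_ge; rewrite divr_gt0 ?mulr_gt0 ?exprn_gt0.
have := stein_bound_match_count p0 p1 pinj ptwo M1 Mt r2 V0 h1.
set sd := Num.sqrt (match_var p pos col); rewrite -/N -/q => bound.
apply: le_trans bound _; rewrite /pattern_constant -[leRHS]mulrA.
rewrite ler_wpM2l ?stein_constant_ge0//.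
set D := moment_factor R r; have D0 : 0 <= D by rewrite ler0n.
pose u := Num.sqrt (N * q); pose m := Num.sqrt M.
have u0 : 0 < u by rewrite sqrtr_gt0 mulr_gt0.
have m0 : 0 < m by rewrite sqrtr_gt0.
have u2 : u ^+ 2 = N * q by rewrite sqr_sqrtr// ltW// mulr_gt0.
have m2 : m ^+ 2 = M by rewrite sqr_sqrtr// ltW.
have um : u * m <= 4 * r%:R * sd.
  rewrite -(ler_pXn2r (n := 2))// ?nnegrE ?mulr_ge0 ?(ltW r0) ?(ltW u0) ?(ltW m0) ?sqrtr_ge0//.
  rewrite exprMn u2 m2 exprMn sqr_sqrtr ?(ltW V0)//.
  have := V_ge; rewrite ler_pdivrMr ?mulr_gt0 ?exprn_gt0//.
  by rewrite (_ : _ * (16 * _) = (4 * r%:R) ^+ 2 * match_var p pos col)//; ring.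
have r40 : 0 < 4 * r%:R :> R by rewrite mulr_gt0.
have ratio := moment_ratio_le u0 m0 r40 um.
rewrite [leLHS](_ : _ = 4 * D ^+ 2 * ((m ^+ 2) ^+ 2 * u ^+ 2 / sd ^+ 3)); last first.
  by rewrite m2 u2; ring.
rewrite -[leRHS]mulrA -[leRHS]mulrA ler_wpM2l ?mulr_ge0 ?sqr_ge0//.
apply: le_trans ratio _; rewrite ler_wpM2l ?exprn_ge0 ?(ltW r40)//.
set mx := Num.max _ _.
have mx0 : 0 <= mx by rewrite le_max sqrtr_ge0.
rewrite -(ler_pXn2r (n := 2))// ?nnegrE ?mulr_ge0 ?(ltW r0) ?invr_ge0 ?(ltW u0) ?(ltW m0)//.
rewrite expr_div_n m2 u2 ler_pdivrMr ?mulr_gt0//.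
have nq0 : 0 < n ^+ 2 * q by rewrite mulr_gt0 ?exprn_gt0.
have Mmx : M <= mx ^+ 2 * (n ^+ 2 * q).
  (* The two entries of [M] match those of the maximum: dividing by [n^2 q] turns 1 into
     [1 / (n^2 q)] and [n qs] into [1 / (n b)]. *)
  rewrite ge_max; apply/andP; split.
    rewrite -ler_pdivrMr// -[leLHS](@sqr_sqrtr R); last by rewrite divr_ge0// ltW.
    by rewrite lerXn2r ?nnegrE ?sqrtr_ge0// div1r le_max lexx.
  rewrite -ler_pdivrMr// -[leLHS](@sqr_sqrtr R); last first.
    by rewrite divr_ge0 ?mulr_ge0// ltW.
  rewrite lerXn2r ?nnegrE ?sqrtr_ge0// (_ : _ / _ = (n * b)^-1).
    by rewrite le_max lexx orbT.
  by rewrite qE; field; rewrite !gt_eqF.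
apply: le_trans Mmx _.
rewrite [leRHS](_ : _ = mx ^+ 2 * (4 * r%:R ^+ 2 * N * q)); last by ring.
by rewrite ler_wpM2l ?sqr_ge0// ler_wpM2r// ltW.
Qed.

(** * Arithmetic progressions *)

Section ArithmeticProgressions.
Variables (c r n : nat).
Hypothesis r_ge2 : (2 <= r)%N.

Definition progression := {x : r.-tuple 'I_n | `[< is_AP x >]}.

Definition term (x : progression) (s : 'I_r) : 'I_n := tnth (val x) s.

Lemma progressionP (x : progression) : exists x0 d : nat, (0 < d)%N /\
  forall s, term x s = (x0 + s * d)%N :> nat.
Proof. exact/asboolP/(valP x). Qed.

Lemma term_inj (x : progression) : injective (term x).
Proof.
move=> s t; have [x0 [d [d0 xE]]] := progressionP x.
move/(congr1 val); rewrite /= !xE => /eqP; rewrite eqn_add2l eqn_pmul2r// => /eqP.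
exact: val_inj.
Qed.

Lemma term_two_inj (s t : 'I_r) : s != t ->
  injective (fun x => (term x s, term x t)).
Proof.
clear r_ge2; move=> st x y [/(congr1 val) /= es /(congr1 val) /= et].
have [x0 [d [_ xE]]] := progressionP x; have [y0 [e [_ yE]]] := progressionP y.
rewrite !xE !yE in es et.
have [de xy] : d = e /\ x0 = y0.
  have st' : (s : nat) != t by [].
  have de : d = e.
    move: st'; rewrite neq_ltn => /orP[] lt_st; nia.
  by split => //; move: es; rewrite de; lia.
apply/val_inj/eq_from_tnth => i; apply: val_inj.
by rewrite -[LHS]/(val (term x i)) -[RHS]/(val (term y i)) /= xE yE de xy.
Qed.

(** With [m = n %/ r], starts below [m] and differences from 1 to [m] always fit, since
    [m + (r - 1) m = m r <= n]. The first two terms recover start and difference. *)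
Lemma card_progression_ge : ((n %/ r) ^ 2 <= #|{: progression}|)%N.
Proof.
set m := (n %/ r)%N.
have r_gt0 : (0 < r)%N := ltnW r_ge2.
have bnd (u : 'I_m * 'I_m) (s : 'I_r) : (u.1 + s * u.2.+1 < n)%N.
  have mr : (m * r <= n)%N := leq_trunc_div n r.
  have h1 : (s * u.2.+1 <= r.-1 * m)%N.
    by apply: leq_mul => //; have := ltn_ord s; lia.
  apply: leq_trans mr; have := ltn_ord u.1.
  have -> : (m * r = m + r.-1 * m)%N by rewrite -{1}(prednK r_gt0) mulnS mulnC.
  lia.
pose ap (u : 'I_m * 'I_m) : r.-tuple 'I_n :=
  [tuple Ordinal (bnd u s) | s < r].
have apP u : `[< is_AP (ap u) >].
  by apply/asboolP; exists u.1, u.2.+1; split => // s; rewrite tnth_mktuple.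
pose f (u : 'I_m * 'I_m) : progression := exist _ (ap u) (apP u).
have f_inj : injective f.
  move=> u v /(congr1 val) /= uv.
  have E (s : 'I_r) : (u.1 + s * u.2.+1 = v.1 + s * v.2.+1)%N.
    by have := congr1 (fun x => val (tnth x s)) uv; rewrite !tnth_mktuple.
  have := E (Ordinal r_gt0); have := E (Ordinal r_ge2); rewrite /= => E1 E0.
  case: u v {uv E} E0 E1 => [u1 u2] [v1 v2] /= E0 E1.
  by congr (_, _); apply: val_inj; rewrite /=; lia.
have := leq_card f f_inj; rewrite card_prod card_ord mulnn.
by [].
Qed.

Lemma sqr_le_card_progression : (r <= n)%N ->
  (n ^ 2 <= 4 * r ^ 2 * #|{: progression}|)%N.
Proof.
move=> rn; have r_gt0 : (0 < r)%N := ltnW r_ge2.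
apply: leq_trans (leq_mul (leqnn _) card_progression_ge).
rewrite (_ : 4 * r ^ 2 * _ = (2 * r * (n %/ r)) ^ 2)%N; last by rewrite !expnMn.
(* As [r <= n], rounding the quotient down loses at most a factor 2. *)
rewrite leq_exp2r//; have := ltn_ceil n r_gt0.
have : (0 < n %/ r)%N by rewrite divn_gt0.
nia.
Qed.

Lemma match_count_progression (R : realType) (a : admissible_palette c r)
    (w : {ffun 'I_n -> 'I_c}) :
  match_count R term (fun s => embed_color (tnth a s)) w =
  (num_colorful_AP w a)%:R.
Proof.
have indE (x : progression) :
    match_ind R term (fun s => embed_color (tnth a s)) x w =
    (colorful w a (val x))%:R.
  rewrite /match_ind /match_on /colorful.
  case: forallP => h; first by rewrite big1// => s _; rewrite h.
  have /existsP[s hs] : [exists s, w (tnth (val x) s) != embed_color (tnth a s)].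
    by rewrite -negb_forall; apply/forallP.
  by rewrite (bigD1 s)//= /term (negPf hs) mul0r.
rewrite /match_count /num_colorful_AP.
have -> : #|[set x : r.-tuple 'I_n | `[< is_AP x >] && colorful w a x]%SET| =
    (\sum_(x : progression) colorful w a (val x))%N.
  transitivity #|[set x : progression | colorful w a (val x)]%SET|; last first.
    rewrite -sum1dep_card big_mkcond; apply: eq_bigr => x _.
    by case: colorful.
  rewrite -(card_imset _ val_inj); apply: eq_card => x.
  rewrite inE; apply/andP/imsetP => [[xAP cx]|[y]].
    by exists (exist _ x xAP); rewrite ?inE.
  by rewrite inE => cy ->; split => //; exact: (valP y).
rewrite natr_sum -(eq_bigr _ (fun x _ => indE x)).
by [].
Qed.

End ArithmeticProgressions.

(** * Random colorings on abstract probability spaces *)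

Section FiniteValued.
Context d (T : measurableType d) (R : realType) (P : probability T R).

Lemma measurable_finite_valued (U : finType) (g : T -> U) (F : U -> R) :
  (forall u, measurable (g @^-1` [set u])) -> measurable_fun setT (F \o g).
Proof.
move=> mg _ B _; rewrite setTI.
rewrite [X in measurable X](_ : _ = \bigcup_(u in F @^-1` B) g @^-1` [set u]).
  by apply: fin_bigcup_measurable => //; exact: finite_finset.
apply/seteqP; split=> [t /= Bt|t [u /= Bu gu]]; last by rewrite /= gu.
by exists (g t).
Qed.

(** This replaces an arbitrary probability space by a finite sum: a function of a finite-valued map
    is a combination of indicators of its fibers. *)
Lemma expectation_finite_valued (U : finType) (g : T -> U) (mass F : U -> R) :
  (forall u, measurable (g @^-1` [set u])) ->
  (forall u, P (g @^-1` [set u]) = (mass u)%:E) ->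
  ('E_P[F \o g] = (\sum_u mass u * F u)%:E)%E.
Proof.
move=> mg Pg; rewrite unlock.
have FE t : ((F \o g) t)%:E =
    (\sum_u (F u)%:E * (\1_(g @^-1` [set u]) t)%:E)%E.
  rewrite (bigD1 (g t))//= big1 ?adde0; last first.
    move=> u ut; rewrite indicE memNset ?mule0//=.
    by move=> gu; rewrite gu eqxx in ut.
  by rewrite indicE mem_set// mule1.
under eq_integral do rewrite FE.
have iI u : P.-integrable setT (fun t => ((F u)%:E * (\1_(g @^-1` [set u]) t)%:E)%E).
  by apply: integrableZl => //; exact: integrable_indic.
rewrite integral_sum// -sumEFin; apply: eq_bigr => u _.
rewrite integralZl//; last exact: integrable_indic.
rewrite integral_indic// setIT mulrC EFinM; congr (_ * _)%E; exact: Pg.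
Qed.

End FiniteValued.

Section RandomColoring.
Context (R : realType) d (T : measurableType d) (P : probability T R).
Variables (c n : nat) (p : 'I_c -> R) (phi : 'I_n -> T -> 'I_c).
Hypotheses (n_gt0 : (0 < n)%N) (phi_random : random_coloring P p phi).

Let coloring t : {ffun 'I_n -> 'I_c} := [ffun i => phi i t].

(** For small [n] the last value of [color_prob] may be negative, so this is read off from the law
    of one colored point, which must exist: hence [n_gt0]. *)
Lemma random_coloring_ge0 b : 0 <= p b.
Proof.
by rewrite -lee_fin -(coloring_law phi_random (Ordinal n_gt0) b).
Qed.

Lemma random_coloring_sum1 : \sum_b p b = 1.
Proof.
have := @expectation_finite_valued _ _ _ P _ (phi (Ordinal n_gt0)) p (fun=> 1)
  (fun u => coloring_measurable phi_random _ _)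
  (fun u => coloring_law phi_random _ _).
under eq_bigr do rewrite mulr1.
rewrite unlock (eq_integral (cst 1%:E))// integral_cst//=.
by rewrite probability_setT mule1 => -[].
Qed.

Let coloring_preimage w : coloring @^-1` [set w] =
  \bigcap_(i in [set` [set: 'I_n]%SET]) (phi i @^-1` [set w i]).
Proof.
apply/seteqP; split => t /=.
  by move=> <- i _; rewrite /= ffunE.
by move=> h; apply/ffunP => i; rewrite ffunE; apply: h; rewrite /= inE.
Qed.

Let measurable_coloring_preimage w : measurable (coloring @^-1` [set w]).
Proof.
rewrite coloring_preimage; apply: fin_bigcap_measurable => // i _.
exact: (coloring_measurable phi_random).
Qed.

(** Independence over the full set of points gives each coloring exactly its product weight. *)
Lemma expectation_coloring (F : {ffun 'I_n -> 'I_c} -> R) :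
  ('E_P[F \o coloring] = (ex p F)%:E)%E.
Proof.
apply: expectation_finite_valued => // w; rewrite coloring_preimage.
rewrite (coloring_independent phi_random) /prod_weight -prodEFin.
by apply: eq_big => [i|i _]; [rewrite inE|exact: (coloring_law phi_random)].
Qed.

Section Progressions.
Variables (r : nat) (a : admissible_palette c r).
Hypothesis r_ge2 : (2 <= r)%N.

Let col s := embed_color (tnth a s).
Let pos := @term r n.

Let p_ge0 := random_coloring_ge0.
Let p_sum1 := random_coloring_sum1.

Let countE : colorful_count R phi a = match_count R pos col \o coloring.
Proof.
apply/funext => t; rewrite /colorful_count /= match_count_progression.
congr (num_colorful_AP _ _)%:R.
by apply/funext => i; rewrite ffunE.
Qed.

Lemma standardize_colorful_count :
  standardize P (colorful_count R phi a) =
  standardized_count p pos col \o coloring.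
Proof.
have EX : fine 'E_P[colorful_count R phi a]%E =
    #|{: progression r n}|%:R * match_prob p col.
  rewrite countE expectation_coloring /= /match_count ex_sum.
  under eq_bigr do rewrite (ex_match_ind _ p_sum1 (@term_inj _ _)).
  by rewrite sumr_const mulr_natl.
have VX : fine 'V_P[colorful_count R phi a]%E = match_var p pos col.
  rewrite /variance unlock EX countE.
  rewrite (_ : _ * _ = (fun w => (match_count R pos col w -
    #|{: progression r n}|%:R * match_prob p col) ^+ 2) \o coloring).
    by rewrite expectation_coloring.
  by apply/funext => t; rewrite /= expr2.
by apply/funext => t; rewrite /standardize EX VX countE.
Qed.

Lemma measurable_standardize_colorful_count :
  measurable_fun setT (standardize P (colorful_count R phi a)).
Proof.
by rewrite standardize_colorful_count; exact: measurable_finite_valued.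
Qed.

Lemma wasserstein_colorful_count (s : 'I_r) : (r <= n)%N ->
  (forall t, p (col s) <= p (col t)) -> 0 < p (col s) ->
  p (col s) * (2 * r%:R ^+ 2) <= 1 ->
  (wasserstein P (standardize P (colorful_count R phi a))
     (normal_prob (0 : R) 1) (fun x : R => x) <=
   (pattern_constant R r *
    Num.max (Num.sqrt (n%:R ^+ 2 * match_prob p col)^-1)
            (Num.sqrt (n%:R * p (col s))^-1))%:E)%E.
Proof.
move=> rn smin b0 br; apply: ge_ereal_sup => _ [h hL <-].
have h1 := lipschitz1P hL.
rewrite expectation_normal_prob// standardize_colorful_count.
rewrite (_ : h \o _ = (fun w => h (standardized_count p pos col w)) \o coloring)//.
rewrite expectation_coloring -EFinB /= lee_fin.
have := @pattern_normal_approximation R _ _ _ r p pos col s p_ge0 p_sum1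
  (@term_inj _ _) (@term_two_inj _ _) r_ge2.
rewrite card_ord; apply => //; exact: sqr_le_card_progression.
Qed.

End Progressions.

End RandomColoring.

(** * Wasserstein bounds and convergence in distribution *)

Section ConvergenceInDistribution.
Variable R : realType.
Implicit Types x y e : R.

(** A smoothed indicator of the half-line up to [x], of height [e] instead of 1 so that a descent
    over length [e] stays 1-Lipschitz. *)
Definition ramp x e y : R := Num.max 0 (Num.min e (x + e - y)).

Let minE_cases x y : Num.min x y = x /\ x <= y \/ Num.min x y = y /\ y <= x.
Proof. by have [xy|/ltW yx] := leP x y; [left|right]. Qed.

Let maxE_cases x y : Num.max x y = x /\ y <= x \/ Num.max x y = y /\ x <= y.
Proof. by have [xy|/ltW yx] := leP x y; [right|left]. Qed.

Lemma ramp_lipschitz x e : 1.-lipschitz (ramp x e : R^o -> R^o).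
Proof.
move=> -[y z] _ /=; rewrite mul1r /ramp.
move: (ler_norm (y - z)) (ler_norm (z - y)); rewrite (distrC z) => h1 h2.
rewrite ler_norml; apply/andP.
move: (minE_cases e (x + e - y)) (maxE_cases 0 (Num.min e (x + e - y))).
move: (minE_cases e (x + e - z)) (maxE_cases 0 (Num.min e (x + e - z))).
by move=> [[? ?]|[? ?]] [[? ?]|[? ?]] [[? ?]|[? ?]] [[? ?]|[? ?]]; split; lra.
Qed.

Lemma ramp_bounds d (T : measurableType d) (P : probability T R) (X : T -> R) x e :
  measurable_fun setT X -> 0 < e ->
  [/\ ('E_P[ramp x e \o X] \is a fin_num)%E,
      e * fine (P [set t | X t <= x]) <= fine 'E_P[ramp x e \o X]%E &
      fine 'E_P[ramp x e \o X]%E <= e * fine (P [set t | X t <= x + e])].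
Proof.
move=> mX e0.
have mset y : measurable [set t | X t <= y].
  rewrite [X in measurable X](_ : _ = setT `&` X @^-1` `]-oo, y]).
    exact: mX.
  by rewrite setTI; apply/seteqP; split => t; rewrite /= in_itv.
have rampP y : e * \1_`]-oo, x] y <= ramp x e y <= e * \1_`]-oo, (x + e)] y.
  rewrite !indicE !mem_setE !in_itv/= /ramp.
  move: (minE_cases e (x + e - y)) (maxE_cases 0 (Num.min e (x + e - y))).
  by move=> [[? ?]|[? ?]] [[? ?]|[? ?]];
    case: (leP y x) => ?; case: (leP y (x + e)) => ?; rewrite /= ?mulr1 ?mulr0;
    apply/andP; split; lra.
have Eind y : (\int[P]_t (e * \1_`]-oo, y] (X t))%:E =
    (e * fine (P [set t | X t <= y]))%:E)%E.
  under eq_integral do rewrite EFinM.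
  rewrite (eq_integral (fun t => e%:E * (\1_[set t | X t <= y] t)%:E)%E); last first.
    move=> t _; rewrite !indicE mem_setE in_itv /=.
    suff -> : (t \in [set t | X t <= y]) = (X t <= y) by [].
    by apply/idP/idP => [/set_mem//|h]; exact/mem_set.
  rewrite integralZl//; last exact: integrable_indic.
  by rewrite integral_indic// setIT EFinM fineK// fin_num_measure.
have mramp : measurable_fun setT (ramp x e \o X).
  apply: measurableT_comp => //; apply: continuous_measurable_fun.
  by apply: lipschitz1_continuous; apply: lipschitz1P; exact: ramp_lipschitz.
have mind y : measurable_fun setT (fun t => e * \1_`]-oo, y] (X t)).
  by apply: measurable_funM => //; apply: (measurableT_comp _ mX).
have ind0 y t : 0 <= e * \1_`]-oo, y] (X t) by rewrite mulr_ge0// ltW.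
have ramp0 t : 0 <= ramp x e (X t) by rewrite /ramp le_max lexx.
have h1 : ((e * fine (P [set t | X t <= x]))%:E <= 'E_P[ramp x e \o X])%E.
  rewrite unlock -Eind; apply: ge0_le_integral => //.
  - by move=> t _; rewrite lee_fin.
  - exact/measurable_EFinP.
  - exact/measurable_EFinP.
  - by move=> t _; rewrite lee_fin; have /andP[] := rampP (X t).
have h2 : ('E_P[ramp x e \o X] <= (e * fine (P [set t | X t <= x + e]))%:E)%E.
  rewrite unlock -Eind; apply: ge0_le_integral => //.
  - by move=> t _; rewrite lee_fin; exact: ramp0.
  - exact/measurable_EFinP.
  - exact/measurable_EFinP.
  - by move=> t _; rewrite lee_fin; have /andP[] := rampP (X t).
have fin : ('E_P[ramp x e \o X] \is a fin_num)%E.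
  rewrite ge0_fin_numE; first exact: le_lt_trans h2 (ltry _).
  by rewrite unlock; apply: integral_ge0 => t _; rewrite lee_fin; exact: ramp0.
by split => //; rewrite -lee_fin fineK.
Qed.

(** The ramps at [x] and [x - e] trap [P (X n <= x)] between the limit distribution function at
    [x - e] and at [x + e], up to an error [b n / e]; continuity at [x] then fixes [e] before [n]
    grows. Measurability is only asked for large [n], where the law of the coloring is known. *)
Lemma wasserstein_cvg_in_distribution (d : nat -> measure_display)
    (T : forall n, measurableType (d n)) (P : forall n, probability (T n) R)
    (X : forall n, T n -> R) d' (T' : measurableType d') (Q : probability T' R)
    (Y : T' -> R) (b : nat -> R) :
  (\forall n \near \oo, measurable_fun setT (X n)) -> measurable_fun setT Y ->
  (\forall n \near \oo, (wasserstein (P n) (X n) Q Y <= (b n)%:E)%E) ->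
  b n @[n --> \oo] --> 0 ->
  converges_in_distribution P X Q Y.
Proof.
move=> mX mY Wb b0 x xc.
rewrite -(fineK (fin_num_measure Q _ _)); last first.
  rewrite [X in measurable X](_ : _ = setT `&` Y @^-1` `]-oo, x]).
    exact: mY.
  by rewrite setTI; apply/seteqP; split => t; rewrite /= in_itv.
apply/fine_cvgP; split.
  near=> n; apply: fin_num_measure.
  have mXn : measurable_fun setT (X n) by near: n.
  rewrite [Z in measurable Z](_ : _ = setT `&` X n @^-1` `]-oo, x]).
    exact: mXn.
  by rewrite setTI; apply/seteqP; split => t; rewrite /= in_itv.
apply/cvgrPdist_le => eta eta0.
move/cvgrPdist_le : xc => /(_ (eta / 2) ltac:(by rewrite divr_gt0)).
rewrite near_nbhs => /nbhs_ballP[e0 /= e00 He0].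
pose e := e0 / 2; have e_gt0 : 0 < e by rewrite divr_gt0.
pose F y := fine (Q [set t | Y t <= y]).
have Fr : `|F x - F (x + e)| <= eta / 2.
  apply: He0; rewrite /ball /= opprD addrA subrr sub0r normrN gtr0_norm//.
  by rewrite /e ltr_pdivrMr// ltr_pMr// ltr1n.
have Fl : `|F x - F (x - e)| <= eta / 2.
  apply: He0; rewrite /ball /= opprB addrCA subrr addr0 gtr0_norm//.
  by rewrite /e ltr_pdivrMr// ltr_pMr// ltr1n.
near=> n; rewrite /= -/(F x).
have mXn : measurable_fun setT (X n) by near: n.
have Wn : (wasserstein (P n) (X n) Q Y <= (b n)%:E)%E by near: n.
(* The extra factor [e] compensates the height of the ramps. *)
have bn : b n <= e * (eta / 2).
  apply: le_trans (ler_norm _) _; rewrite -normrN -sub0r; near: n.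
  by move/cvgrPdist_le : b0; apply; rewrite mulr_gt0// divr_gt0.
have diff y : `|fine 'E_(P n)[ramp y e \o X n]%E - fine 'E_Q[ramp y e \o Y]%E| <= b n.
  have [f1 _ _] := ramp_bounds (P n) y mXn e_gt0.
  have [f2 _ _] := ramp_bounds Q y mY e_gt0.
  rewrite -lee_fin; apply: le_trans Wn; apply: ereal_sup_ubound.
  exists (ramp y e); first exact: ramp_lipschitz.
  by rewrite -{1}(fineK f1) -{1}(fineK f2).
have [_ p1 _] := ramp_bounds (P n) x mXn e_gt0.
have [_ _ q1] := ramp_bounds Q x mY e_gt0.
have [_ _ p2] := ramp_bounds (P n) (x - e) mXn e_gt0.
have [_ q2 _] := ramp_bounds Q (x - e) mY e_gt0.
rewrite subrK in p2.
rewrite -/(F (x + e)) in q1; rewrite -/(F (x - e)) in q2.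
set Pn := fine (P n _) in p1 p2 *.
move: (diff x) (diff (x - e)) Fr Fl; rewrite !ler_norml.
move=> /andP[d1 d2] /andP[d3 d4] /andP[d5 d6] /andP[d7 d8].
rewrite -(ler_pM2l e_gt0) -[X in _ && X](ler_pM2l e_gt0).
have h1 := ler_wpM2l (ltW e_gt0) d5; have h2 := ler_wpM2l (ltW e_gt0) d8.
by apply/andP; split; rewrite ?mulrN ?mulrBr in h1 h2 *; lra.
Unshelve. all: by end_near. Qed.

End ConvergenceInDistribution.

(** * Asymptotics *)

Section Exponents.
Variables (R : realType) (c r : nat) (a : admissible_palette c r).
Variable theta : 'I_c.-1 -> R.
Local Notation col s := (embed_color (tnth a s)).

Lemma color_prob_embed n (b : 'I_c.-1) :
  color_prob theta n (embed_color b) = n%:R `^ (- theta b).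
Proof.
rewrite /color_prob; case: insubP => [b' _ /= bE|]; last by rewrite /= ltn_ord.
by congr (_ `^ (- theta _)); exact: val_inj.
Qed.

Lemma weighted_exponentE :
  weighted_exponent theta a = \sum_(s < r) theta (tnth a s).
Proof.
rewrite [RHS](partition_big (tnth a) (mem (palette_colors a)))/=; last first.
  by move=> s _; rewrite inE mem_tnth.
apply: eq_bigr => b _; rewrite (eq_bigr (fun=> theta b)).
  rewrite sumr_const mulr_natl; congr (_ *+ _).
  by rewrite /multiplicity -sum1_count big_tuple sum1_card.
by move=> s /eqP ->.
Qed.

Lemma match_prob_color_prob n : (0 < n)%N ->
  match_prob (color_prob theta n) (fun s => col s) =
  n%:R `^ (- weighted_exponent theta a).
Proof.
move=> n0; have nn : n%:R != 0 :> R by rewrite pnatr_eq0 -lt0n.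
rewrite weighted_exponentE /match_prob -sumrN.
elim/big_rec2: _ => [|s x y _ ->]; first by rewrite powRr0.
by rewrite color_prob_embed powRD// nn implybT.
Qed.

(** Positive exponents are never below the default 0, so the maximum is attained at a position of
    the palette, that of the rarest color. *)
Lemma max_exponent_attained : (0 < r)%N -> (forall b, 0 < theta b) ->
  exists2 s, max_exponent theta a = theta (tnth a s) &
    forall t, theta (tnth a t) <= theta (tnth a s).
Proof.
move=> r0 th0; have inP t : tnth a t \in palette_colors a by rewrite inE mem_tnth.
have [|b] := @eq_bigmax _ R _ 0 (tnth a (Ordinal r0)) (mem (palette_colors a)) theta (inP _).
  by move=> b _; exact: ltW.
move=> bP maxE; have : b \in palette_colors a by [].
rewrite inE => /tnthP[s bE]; rewrite bE in maxE; exists s => // t.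
by rewrite -maxE; apply: (@le_bigmax_cond _ R); exact: inP.
Qed.

End Exponents.

Section Powers.
Variable R : realType.
Implicit Types e K : R.

Lemma natr_powRN_le e K : 0 < e -> 0 < K ->
  \forall n \near \oo, n%:R `^ (- e) * K <= 1.
Proof.
move=> e0 K0; near=> n.
have n0 : 0 < n%:R :> R by rewrite ltr0n; near: n; exact: nbhs_infty_gt.
rewrite powRN mulrC ler_pdivrMr ?powR_gt0// mul1r.
(* The inequality amounts to [n] being at least [K] to the power [1 / e]. *)
have -> : K = (K `^ e^-1) `^ e.
  by rewrite -powRrM mulVf ?gt_eqF// powRr1// ltW.
apply: ge0_ler_powR; rewrite ?nnegrE ?powR_ge0 ?(ltW e0)//.
by near: n; exact: nbhs_infty_ger.
Unshelve. all: by end_near. Qed.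

Lemma cvg_natr_powRN e : 0 < e -> n%:R `^ (- e) @[n --> \oo] --> (0 : R).
Proof.
move=> e0; apply/cvgrPdist_le => d d0; near=> n.
rewrite sub0r normrN ger0_norm ?powR_ge0// -[leRHS]mul1r -ler_pdivrMr//.
by near: n; have := @natr_powRN_le e d^-1 e0; rewrite invr_gt0; apply.
Unshelve. all: by end_near. Qed.

Lemma sqrt_natr_powR n e (k : nat) : (0 < n)%N ->
  Num.sqrt (n%:R ^+ k * n%:R `^ (- e))^-1 = n%:R `^ (- (k%:R / 2) + e / 2).
Proof.
move=> n0; have n0' : n%:R != 0 :> R by rewrite pnatr_eq0 -lt0n.
rewrite -powR_mulrn// -powRD ?n0' ?implybT// -powRN -powR12_sqrt ?powR_ge0//.
by rewrite -powRrM; congr (_ `^ _); field.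
Qed.

End Powers.

Theorem theorem2p7 (R : realType) (r : nat) (hr : (3 <= r)%N) :
  exists2 C : R, 0 < C &
    forall (c : nat) (hc : (2 <= c)%N) (a : admissible_palette c r)
      (theta : 'I_c.-1 -> R)
      (theta_gt0 : forall b, 0 < theta b)
      (weight_lt2 : weighted_exponent theta a < 2)
      (max_lt1 : max_exponent theta a < 1)
      (d : nat -> measure_display) (T : forall n, measurableType (d n))
      (P : forall n, probability (T n) R)
      (phi : forall n, 'I_n -> T n -> 'I_c)
      (phi_random : \forall n \near \oo,
        random_coloring (P n) (color_prob theta n) (phi n)),
    let Z := fun n => standardize (P n) (colorful_count R (phi n) a) in
    (\forall n \near \oo,
       (wasserstein (P n) (Z n) (normal_prob (0 : R) 1) (fun x : R => x) <=
        (C * Num.max (n%:R `^ (- 1 + weighted_exponent theta a / 2))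
                     (n%:R `^ (- (1 / 2) + max_exponent theta a / 2)))%:E)%E) /\
    converges_in_distribution P Z (normal_prob (0 : R) 1) (fun x : R => x).
Proof.
have C0 : 0 <= pattern_constant R r.
  by rewrite /pattern_constant !mulr_ge0 ?stein_constant_ge0 ?sqr_ge0 ?exprn_ge0 ?mulr_ge0.
have r2 : (2 <= r)%N := ltnW hr.
(* Only nonnegativity of the constant is at hand; adding 1 makes it positive. *)
exists (pattern_constant R r + 1); first by rewrite ltr_wpDl.
move=> c hc a theta theta_gt0 weight_lt2 max_lt1 d T P phi phi_random Z.
have [s maxE smax] := @max_exponent_attained R c r a theta (ltnW r2) theta_gt0.
set A := fun n : nat => n%:R `^ (- 1 + weighted_exponent theta a / 2).
set B := fun n : nat => n%:R `^ (- (1 / 2) + max_exponent theta a / 2).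
have bound : \forall n \near \oo,
    (wasserstein (P n) (Z n) (normal_prob (0 : R) 1) (fun x : R => x) <=
      ((pattern_constant R r + 1) * Num.max (A n) (B n))%:E)%E.
  near=> n.
  have rn : (r <= n)%N by near: n; exact: nbhs_infty_ge.
  have n0 : (0 < n)%N by apply: leq_trans rn; exact: ltnW.
  have n1 : 1 <= n%:R :> R by rewrite ler1n.
  have phin : random_coloring (P n) (color_prob theta n) (phi n) by near: n.
  apply: le_trans (@wasserstein_colorful_count _ _ _ _ _ _ _ _ n0 phin r a r2 s rn _ _ _) _.
  - by move=> t; rewrite !color_prob_embed ler_powR// lerN2.
  - by rewrite color_prob_embed powR_gt0// ltr0n.
  - rewrite color_prob_embed; near: n; apply: natr_powRN_le => //.
    by rewrite mulr_gt0// exprn_gt0// ltr0n (ltnW r2).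
  rewrite match_prob_color_prob// color_prob_embed -maxE.
  (* The first power of [n] is made explicit so that [sqrt_natr_powR] covers both terms, with
     [k = 2] and [k = 1]. *)
  rewrite -[X in Num.sqrt (X * n%:R `^ (- max_exponent _ _))^-1]expr1.
  rewrite !sqrt_natr_powR// divff ?pnatr_eq0// lee_fin.
  apply: ler_wpM2r; last by rewrite lerDl.
  by rewrite le_max powR_ge0.
split; first exact: bound.
apply: (@wasserstein_cvg_in_distribution _ _ _ _ _ _ _ _ _
  (fun n => (pattern_constant R r + 1) * (A n + B n))).
- near=> n.
  have n0 : (0 < n)%N by near: n; exact: nbhs_infty_gt.
  have phin : random_coloring (P n) (color_prob theta n) (phi n) by near: n.
  exact: (measurable_standardize_colorful_count n0 phin).
- exact: measurable_id.
- near=> n; have Wn : (wasserstein (P n) (Z n) (normal_prob (0 : R) 1) (fun x : R => x) <=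
      ((pattern_constant R r + 1) * Num.max (A n) (B n))%:E)%E by near: n.
  apply: le_trans Wn _; rewrite lee_fin ler_wpM2l ?addr_ge0//.
  by rewrite ge_max lerDl lerDr !powR_ge0.
(* With the maximum relaxed to a sum, each power tends to 0 separately: [weight_lt2] and [max_lt1]
   make the two exponents negative. *)
- rewrite -(mulr0 (pattern_constant R r + 1)); apply: cvgM; first exact: cvg_cst.
  rewrite -(addr0 0); apply: cvgD.
    rewrite /A (_ : -1 + _ = - (1 - weighted_exponent theta a / 2)).
      by apply: cvg_natr_powRN; lra.
    by rewrite opprB addrC.
  rewrite /B (_ : - (1 / 2) + _ = - (1 / 2 - max_exponent theta a / 2)).
    by apply: cvg_natr_powRN; lra.
  by rewrite opprB addrC.
Unshelve. all: by end_near. Qed.
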